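(* Let $A\in\mathscr{B}(\mathscr{H})$ and $0\le t\le 1$. Then \[ \omega(A)\le \frac12\sqrt{\frac14\left\||A|^{4t}+|A|^{4(1-t)}\right\|+\frac12\|A\|^2+\frac14\left\||\widetilde{A}_t|^2+|\widetilde{A}_t^{*}|^2\right\|+\frac12\,\omega\!\left(\widetilde{A}_t^{\,2}\right)+\left\||A|^{2t}+|A|^{2(1-t)}\right\|\,\omega\!\left(\widetilde{A}_t\right)}. \]
   Context: $\mathscr{B}(\mathscr{H})$ is the $C^*$-algebra of all bounded linear operators on a complex Hilbert space $\mathscr{H}$ with inner product $\langle\cdot,\cdot\rangle$. For $T\in\mathscr{B}(\mathscr{H})$: the numerical radius is $\omega(T)=\sup_{\|x\|=1}|\langle Tx,x\rangle|$; $\|T\|=\sup_{\|x\|=1}\|Tx\|$ is the operator norm; $T^*$ is the adjoint; $|T|=(T^*T)^{1/2}$. Real powers of positive operators are defined by the continuous functional calculus, with $T^0=I$. The weighted Aluthge transform of $A$ is $\widetilde{A}_t=|A|^{1-t}U|A|^{t}$ for $0\le t\le 1$, where $U$ is the partial isometry in the polar decomposition $A=U|A|$ (so $\ker U=\ker A$). $\widetilde{A}_t^{*}$ denotes the adjoint $(\widetilde{A}_t)^*$ and $\widetilde{A}_t^{\,2}=(\widetilde{A}_t)^2$. *)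

(* Defs.v *)
From HB Require Import structures.
From mathcomp Require Import all_boot all_order all_algebra sesquilinear.
From mathcomp Require Import complex.
From mathcomp Require Import all_classical all_reals all_analysis.

Set Implicit Arguments.
Unset Strict Implicit.
Unset Printing Implicit Defensive.

Import Order.TTheory GRing.Theory Num.Theory.
Import numFieldNormedType.Exports.

Local Open Scope classical_set_scope.
Local Open Scope complex_scope.
Local Open Scope ring_scope.

HB.mixin Record NormedModule_hasInner (R : realType) H
    & NormedModule R[i] H := {
  inner : {dot H for (@conjc R)} ;
  inner_norm : forall x : H, inner x x = `|x| ^+ 2
}.

(* Complex Hilbert spaces; [inner] is linear in its first argument and
   conjugate-linear in the second. *)
#[short(type="hilbertType")]
HB.structure Definition Hilbert (R : realType) :=
  { H of CompleteNormedModule R[i] H & NormedModule_hasInner R H }.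

(* The norm of a normed module over R[i], hence also the modulus on R[i], has
   values in R[i]; [rnorm] is the same number seen in R. *)
Definition rnorm (R : realType) (V : normedZmodType R[i]) (x : V) : R :=
  complex.Re `|x|.

Section Operators.
Variables (R : realType) (H : hilbertType R).
Implicit Types (T S U P : H -> H).

(* Operators are plain functions, with the pointwise + and - and scaling of the
   library; [bounded_operator T] says that T is an element of B(H). *)
Definition bounded_operator T : Prop :=
  linear T /\ exists M : R, forall x, rnorm (T x) <= M * rnorm x.

(* If H is the zero space, both suprema below are taken over the empty set and
   are equal to 0. *)
Definition opnorm T : R := sup [set rnorm (T x) | x in [set x | rnorm x = 1]].

Definition numradius T : R :=
  sup [set rnorm (inner (T x) x) | x in [set x | rnorm x = 1]].

Definition adjoint T : H -> H :=
  get [set S | bounded_operator S /\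
               forall x y, inner (T x) y = inner x (S y)].

Definition spectrum T : set R[i] :=
  [set l | ~ exists S, [/\ bounded_operator S,
                           cancel (T - l *: (id : H -> H)) S
                         & cancel S (T - l *: (id : H -> H))]].

Definition opoly (p : {poly R}) T : H -> H :=
  \sum_(i < size p) (p`_i)%:C *: iter i T.

(* Continuous functional calculus, for a self-adjoint P (whose spectrum is real)
   and a real function f continuous on the spectrum of P: f(P) is the operator
   norm limit of p(P) as the polynomials p tend to f uniformly on its
   spectrum. *)
Definition fcalc (f : R -> R) P : H -> H :=
  get [set S | bounded_operator S /\
    forall e : R, 0 < e -> exists p : {poly R},
      (forall x : R, spectrum P x%:C -> `|p.[x] - f x| <= e) /\
      opnorm (opoly p P - S) <= e].

(* Since 0 `^ 0 = 1 for the library's power function, opow P 0 = id. *)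
Definition opow P (s : R) : H -> H := fcalc (fun x => x `^ s) P.

Definition opabs T : H -> H := opow (adjoint T \o T) 2^-1.

(* U is isometric on the orthogonal complement of its kernel. *)
Definition partial_isometry U : Prop :=
  bounded_operator U /\
  forall x, (forall y, U y = 0 -> inner x y = 0) -> `|U x| = `|x|.

Definition polar_isometry T : H -> H :=
  get [set U | [/\ partial_isometry U, T = U \o opabs T
                 & forall x, U x = 0 <-> T x = 0]].

Definition aluthge T (t : R) : H -> H :=
  opow (opabs T) (1 - t) \o polar_isometry T \o opow (opabs T) t.

End Operators.

(* Main.v *)
Require Import Defs.
From HB Require Import structures.
From mathcomp Require Import all_boot all_order all_algebra sesquilinear.
From mathcomp Require Import complex.
From mathcomp Require Import all_classical all_reals all_analysis.
From mathcomp Require Import ring lra.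

(** Write A = U|A| for the polar decomposition, X = |A|^(1-t), Z = |A|^t, so that
    X and Z are positive, ZX = |A| and the transform is At = XUZ.  Then
    <Ax, x> = <Xx, Z U^* x>.  Choose c of modulus 1 with c<Ax, x> = |<Ax, x>| and
    put B = cX + Z U^*.  From ||u + v||^2 - 4 Re<u, v> = ||u - v||^2 >= 0 one gets
    4 |<Ax, x>| <= ||Bx||^2.  Since U is a contraction,
      B B^* = X^2 + Z U^*U Z + c At + c^* At^*  <=  C + D,
    with C = |A|^(2t) + |A|^(2(1-t)) and D = c At + c^* At^*, so any k such that
    ||(C + D)y|| <= k||y|| for all y satisfies 4 |<Ax, x>| <= k||x||^2
    ([rotated_bound]).  It remains to expand
      ||(C + D)y||^2 = ||Cy||^2 + ||Dy||^2 + 2 Re<Cy, Dy>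
    ([sum_bound]):
    - C^2 = |A|^(4t) + |A|^(4(1-t)) + 2|A|^2 ([modulus_part_sqr]);
    - ||Dy||^2 = ||At y||^2 + ||At^* y||^2 + 2 Re c^2<At At y, y>, where the first two
      terms form the quadratic form of |At|^2 + |At^*|^2 ([rotated_part_sqr]);
    - D is symmetric with |<Dy, y>| <= 2 w(At) ||y||^2, hence ||D|| <= 2 w(At), which
      bounds the cross term ([symmetric_norm_le]).
    The sum of the three bounds is four times the number under the square root.

    The operators in the statement are selected by their defining properties, so each
    of them has to be shown to exist.  Adjoints come from the Riesz representation
    theorem and the isometry U from extending |A|x |-> Ax by continuity; both rest on
    the orthogonal projection onto the closure of a subspace ([projection]).

    Powers of a positive operator P are limits of p(P) for polynomials p that
    approximate the power on the spectrum only.  The limit does not depend on the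
    approximating polynomials because ||p(P)|| is at most the supremum of |p| on the
    spectrum ([opoly_norm_le]).  This follows from the positivity statement
    [opoly_ge0]: if the quadratic form of p(P) took a negative value, its infimum
    m < 0 on the unit sphere would be an approximate eigenvalue of p(P); factoring
    p - m over the complex numbers, some root r of p - m is an approximate eigenvalue
    of P, so r is real, belongs to the spectrum and p(r) = m < 0.  The limit exists because the spectrum lies in an
    interval [0, K] ([spectrum_positive]), on which Bernstein polynomials approximate
    the power ([approximable_powR]).  Multiplicativity of the calculus
    ([represents_comp]) then gives the laws of exponents used above. *)

Set Implicit Arguments.
Unset Strict Implicit.
Unset Printing Implicit Defensive.

Import Order.TTheory GRing.Theory Num.Theory.
Import numFieldNormedType.Exports.

Local Open Scope classical_set_scope.
Local Open Scope ring_scope.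

(** * Norms and inner products with real values *)

Section Norm.
Variables (R : realType) (V : normedZmodType R[i]).
Implicit Types x y : V.

Lemma norm_rnorm x : `|x| = (rnorm x)%:C%C.
Proof. by rewrite /rnorm RRe_real // normr_real. Qed.

Lemma rnorm_ge0 x : 0 <= rnorm x.
Proof. by rewrite -lecR -norm_rnorm normr_ge0. Qed.

Lemma rnormD x y : rnorm (x + y) <= rnorm x + rnorm y.
Proof. by rewrite -lecR rmorphD /= -!norm_rnorm ler_normD. Qed.

Lemma rnormN x : rnorm (- x) = rnorm x.
Proof. by rewrite /rnorm normrN. Qed.

Lemma rnorm0 : rnorm (0 : V) = 0.
Proof. by rewrite /rnorm normr0. Qed.

Lemma rnorm0_eq0 x : rnorm x = 0 -> x = 0.
Proof. by move=> h; apply: normr0_eq0; rewrite norm_rnorm h. Qed.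

Lemma rdistC x y : rnorm (x - y) = rnorm (y - x).
Proof. by rewrite -rnormN opprB. Qed.

Lemma rdist_triangle y x z : rnorm (x - z) <= rnorm (x - y) + rnorm (y - z).
Proof. by apply: le_trans (rnormD _ _); rewrite addrA subrK. Qed.

(** The form in which every passage to the limit below concludes: two vectors that
    are both approximated up to a multiple of e, for all e, coincide. *)
Lemma rdist_small_eq x y (C : R) :
  (forall e : R, 0 < e -> rnorm (x - y) <= C * e) -> x = y.
Proof.
move=> h; apply/eqP; rewrite -subr_eq0; apply/eqP/rnorm0_eq0/eqP.
rewrite eq_le rnorm_ge0 andbT leNgt; apply/negP => n0.
have := h (rnorm (x - y) / (2 * (1 + `|C|))).
have C0 : 0 < 2 * (1 + `|C|) by rewrite mulr_gt0 // ltr_pwDl.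
rewrite divr_gt0 // => /(_ isT); apply/negP; rewrite -ltNge.
rewrite mulrCA gtr_pMr// ltr_pdivrMr // mul1r.
by have := ler_norm C; have := normr_ge0 C; lra.
Qed.
End Norm.

Lemma rnormZ (R : realType) (V : normedModType R[i]) (a : R[i]) (x : V) :
  rnorm (a *: x) = rnorm a * rnorm x.
Proof.
apply: (@complexI R); rewrite rmorphM /=.
by rewrite -!norm_rnorm normrZ.
Qed.

Section Inner.
Variables (R : realType) (H : hilbertType R).
Implicit Types (x y z : H) (a : R[i]).

Lemma innerDl x y z : inner (x + y) z = inner x z + inner y z.
Proof. by rewrite linearDl. Qed.
Lemma innerDr x y z : inner z (x + y) = inner z x + inner z y.
Proof. by rewrite linearDr. Qed.
Lemma innerZl a x z : inner (a *: x) z = a * inner x z.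
Proof. by rewrite linearZl_LR. Qed.
Lemma innerZr a x z : inner z (a *: x) = conjc a * inner z x.
Proof. by rewrite linearZr_LR. Qed.
Lemma innerC x y : inner x y = conjc (inner y x).
Proof. by rewrite hermitian_subproof expr0 mul1r. Qed.
Lemma inner_sqr x : inner x x = ((rnorm x) ^+ 2)%:C%C.
Proof. by rewrite inner_norm norm_rnorm rmorphXn. Qed.
Lemma innerNl x y : inner (- x) y = - inner x y.
Proof. by rewrite linearNl. Qed.
Lemma innerNr x y : inner x (- y) = - inner x y.
Proof. by rewrite linearNr. Qed.
Lemma inner0l x : inner 0 x = 0. Proof. by rewrite linear0l. Qed.
Lemma inner0r x : inner x 0 = 0. Proof. by rewrite linear0r. Qed.

Definition rip x y : R := complex.Re (inner x y).

Lemma ripC x y : rip x y = rip y x.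
Proof. by rewrite /rip innerC; case: (inner y x). Qed.
Lemma ripDl x y z : rip (x + y) z = rip x z + rip y z.
Proof. by rewrite /rip innerDl raddfD. Qed.
Lemma ripDr x y z : rip z (x + y) = rip z x + rip z y.
Proof. by rewrite /rip innerDr raddfD. Qed.
Lemma ripNl x y : rip (- x) y = - rip x y.
Proof. by rewrite /rip innerNl raddfN. Qed.
Lemma ripNr x y : rip x (- y) = - rip x y.
Proof. by rewrite /rip innerNr raddfN. Qed.
Lemma ripZl (r : R) x y : rip (r%:C%C *: x) y = r * rip x y.
Proof. by rewrite /rip innerZl; case: (inner x y) => a b /=; ring. Qed.
Lemma ripZr (r : R) x y : rip x (r%:C%C *: y) = r * rip x y.
Proof. by rewrite ripC ripZl ripC. Qed.
Lemma rip_sqr x : rip x x = rnorm x ^+ 2.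
Proof. by rewrite /rip inner_sqr. Qed.

Lemma rnormC (r : R) : rnorm (r%:C)%C = `|r|.
Proof. by apply: (@complexI R); rewrite -norm_rnorm normc_def /= expr0n addr0 sqrtr_sqr. Qed.

Lemma rnormM (u v : R[i]) : rnorm (u * v) = rnorm u * rnorm v.
Proof. by apply: (@complexI R); rewrite rmorphM /= -!norm_rnorm normrM. Qed.

Definition ripE := (ripDl, ripDr, ripNl, ripNr, ripZl, ripZr).

Lemma rnormD_sqr x y :
  rnorm (x + y) ^+ 2 = rnorm x ^+ 2 + 2 * rip x y + rnorm y ^+ 2.
Proof. by rewrite -!rip_sqr !ripE (ripC y x); ring. Qed.

Lemma rnormB_sqr x y :
  rnorm (x - y) ^+ 2 = rnorm x ^+ 2 - 2 * rip x y + rnorm y ^+ 2.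
Proof. by rewrite rnormD_sqr ripNr rnormN; ring. Qed.

Lemma rip_le x y : rip x y <= rnorm x * rnorm y.
Proof.
have h := rnormD x y; have := rnormD_sqr x y.
have := rnorm_ge0 x; have := rnorm_ge0 y; have := rnorm_ge0 (x + y).
move=> h1 h2 h3.
have : rnorm (x + y) ^+ 2 <= (rnorm x + rnorm y) ^+ 2 by rewrite lerXn2r ?nnegrE //; lra.
by rewrite sqrrD; lra.
Qed.

(** Reduces a bound on a modulus to a bound on a real part: [inner_le] follows in
    this way from [rip_le], and the numerical radius is treated likewise. *)
Lemma rotation (w : R[i]) : exists2 c : R[i], rnorm c = 1 & c * w = (rnorm w)%:C%C.
Proof.
have [->|w0] := eqVneq w 0; first by exists 1; rewrite ?mulr0 ?rnorm0// /rnorm normr1.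
have n0 : `|w| != 0 by rewrite normr_eq0.
exists (`|w| / w); last by rewrite divfK // -norm_rnorm.
by rewrite /rnorm normrM normrV ?unitfE // normr_id divff.
Qed.

Lemma inner_le x y : rnorm (inner x y) <= rnorm x * rnorm y.
Proof.
have [c c1 cE] := rotation (inner x y).
have := rip_le (c *: x) y.
by rewrite /rip innerZl cE /= rnormZ c1 mul1r.
Qed.

Lemma rip_inj x y : (forall z, rip x z = rip y z) -> x = y.
Proof.
move=> h; apply/eqP; rewrite -subr_eq0; apply/eqP/rnorm0_eq0/eqP.
by rewrite -sqrf_eq0 -rip_sqr ripDl ripNl h subrr.
Qed.

Lemma inner_Im x y : complex.Im (inner x y) = rip x ('i%C *: y).
Proof. by rewrite /rip innerZr; case: (inner x y) => a b /=; ring. Qed.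

(** Completeness without sequences.  [F e y] reads: y is an approximation of quality
    e of the object under construction; if two approximations differ by at most
    a multiple of the sum of their qualities, the object exists, and the bound
    against each approximation comes with it.  Projections, inverses, operator limits
    and the polar isometry are all obtained from this lemma. *)
Lemma approx_limit (F : R -> H -> Prop) (C : R) :
  (forall e : R, 0 < e -> exists y, F e y) ->
  (forall e1 e2 y1 y2, F e1 y1 -> F e2 y2 -> rnorm (y1 - y2) <= C * (e1 + e2)) ->
  exists l, forall e y, F e y -> rnorm (y - l) <= C * e.
Proof.
move=> Fex FC.
have /choice[u uF] : forall n : nat, exists y, F (n.+1%:R)^-1 y.
  by move=> n; apply: Fex; rewrite invr_gt0.
have small (d : R) : 0 < d -> \forall n \near \oo, C * n.+1%:R^-1 < d.
  move=> d0; have c0 : 0 < 1 + `|C| by rewrite ltr_pwDl.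
  have := near_infty_natSinv_lt (PosNum (divr_gt0 d0 c0)).
  apply: filterS => n /=; rewrite ltr_pdivlMr // => h.
  apply: le_lt_trans h; rewrite mulrC ler_wpM2l ?invr_ge0 //.
  by have := ler_norm C; lra.
have ucvg : cvg (u @ \oo).
  apply: cauchy_cvg; apply: cauchy_exP => eps eps0.
  have [d d0 ->] : exists2 d : R, 0 < d & eps = d%:C%C.
    exists (complex.Re eps); last by rewrite RRe_real // gtr0_real.
    by rewrite -ltcR RRe_real // gtr0_real.
  have [N _ hN] := small _ (divr_gt0 d0 (ltr0n R 2)).
  exists (u N); exists N => // n /= Nn; rewrite -ball_normE /= norm_rnorm ltcR.
  apply: le_lt_trans (FC _ _ _ _ (uF N) (uF n)) _.
  move: (hN N (leqnn N)) (hN n Nn) => /=.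
  by rewrite (mulrDr C); move: (C / _) (C / _) => a b; lra.
exists (lim (u @ \oo)) => e y Fy.
apply/ler_addgt0Pr => d d0.
have d2 : 0 < d / 2 by rewrite divr_gt0.
have /cvgrPdist_le/(_ ((d / 2)%:C)%C) := ucvg.
rewrite ltcR => /(_ d2) hl; near \oo => n.
apply: le_trans (rdist_triangle (u n) _ _) _.
have h1 := FC _ _ _ _ Fy (uF n).
have h2 : rnorm (u n - lim (u @ \oo)) <= d / 2.
  by rewrite rdistC -lecR -norm_rnorm; near: n.
have h3 : C * n.+1%:R^-1 < d / 2 by near: n; exact: small.
move: h1 h2 h3; rewrite (mulrDr C); move: (C / _) => a; lra.
Unshelve. all: by end_near.
Qed.
End Inner.

(** * Linear maps, orthogonal projection, adjoints *)

Section LinearMaps.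
Variables (K : nzRingType) (V W : lmodType K) (T : V -> W).
Hypothesis linT : linear T.

Lemma linD x y : T (x + y) = T x + T y.
Proof. by have := linT 1 x y; rewrite !scale1r. Qed.
Lemma lin0 : T 0 = 0.
Proof. by apply: (addrI (T 0)); rewrite -linD !addr0. Qed.
Lemma linZ a x : T (a *: x) = a *: T x.
Proof. by have := linT a x 0; rewrite !addr0 lin0 addr0. Qed.
Lemma linN x : T (- x) = - T x.
Proof. by rewrite -scaleN1r linZ scaleN1r. Qed.
Lemma linB x y : T (x - y) = T x - T y.
Proof. by rewrite linD linN. Qed.
End LinearMaps.

Section Projection.
Variables (R : realType) (H : hilbertType R).
Implicit Types (x y z v w : H) (a : R[i]).

(** First-order condition at a minimum: a quadratic polynomial in c without constant
    term can only be nonnegative everywhere if its linear coefficient vanishes. *)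
Lemma linear_coef_eq0 (a b : R) : 0 <= a ->
  (forall c, 0 <= - (2 * c * b) + c ^+ 2 * a) -> b = 0.
Proof.
move=> a0 h; have a1 : 0 < a + 1 by lra.
have := h (b / (a + 1)).
have -> : - (2 * (b / (a + 1)) * b) + (b / (a + 1)) ^+ 2 * a =
          - (b ^+ 2 * ((a + 2) / (a + 1) ^+ 2)).
  by field; lra.
rewrite oppr_ge0 pmulr_lle0; last by rewrite divr_gt0 ?exprn_gt0 //; lra.
by move=> b2; apply/eqP; rewrite -sqrf_eq0 eq_le b2 sqr_ge0.
Qed.

(** V need not be closed: m is the projection of x onto the closure of V, expressed
    by approximability.  Minimizing sequences converge by the parallelogram identity,
    and minimality of the distance gives the orthogonality. *)
Lemma projection (V : H -> Prop) x : V 0 ->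
  (forall a y z, V y -> V z -> V (a *: y + z)) ->
  exists m, (forall e : R, 0 < e -> exists2 v, V v & rnorm (m - v) <= e) /\
            (forall v, V v -> inner (x - m) v = 0).
Proof.
move=> V0 Vlin.
pose D := [set rnorm (x - v) | v in V].
have Dinf : has_inf D.
  by split; [exists (rnorm (x - 0)), 0 | exists 0 => _ [v _ <-]; apply: rnorm_ge0].
pose d := inf D.
have dle v : V v -> d <= rnorm (x - v) by move=> Vv; apply: ge_inf; [case: Dinf|exists v].
have d0 : 0 <= d by apply: lb_le_inf; [case: Dinf|move=> _ [v _ <-]; apply: rnorm_ge0].
pose F (e : R) v := [/\ 0 < e, V v & rnorm (x - v) ^+ 2 <= d ^+ 2 + e ^+ 2 / 2].
have Fex (e : R) : 0 < e -> exists v, F e v.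
  move=> e0.
  have dlt : d < Num.sqrt (d ^+ 2 + e ^+ 2 / 2).
    rewrite -{1}(ger0_norm d0) -sqrtr_sqr ltr_sqrt ?ltrDl ?divr_gt0 ?exprn_gt0 //.
    by rewrite ltr_pwDr ?divr_gt0 ?exprn_gt0 ?exprn_ge0.
  have [_ [v Vv <-] hv] : exists2 r, D r & r < Num.sqrt (d ^+ 2 + e ^+ 2 / 2).
    by apply: inf_lt; first by case: Dinf.
  exists v; split => //.
  rewrite -[leRHS]sqr_sqrtr; last by rewrite addr_ge0 ?divr_ge0 ?exprn_ge0 // ltW.
  by rewrite lerXn2r ?nnegrE ?rnorm_ge0 ?sqrtr_ge0 // ltW.
have FC (e1 e2 : R) v1 v2 : F e1 v1 -> F e2 v2 -> rnorm (v1 - v2) <= 1 * (e1 + e2).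
  move=> [e1p V1 h1] [e2p V2 h2]; rewrite mul1r.
  (* The midpoint of v1 and v2 is at distance at least d from x. *)
  have Vm : V ((2^-1 : R)%:C%C *: v1 + ((2^-1 : R)%:C%C *: v2 + 0)).
    by apply: (Vlin) => //; apply: (Vlin).
  have := dle _ Vm.
  have E1 : x - ((2^-1 : R)%:C%C *: v1 + ((2^-1 : R)%:C%C *: v2 + 0)) =
    (2^-1 : R)%:C%C *: ((x - v1) + (x - v2)).
    rewrite addr0 -scalerDr addrACA -opprD scalerBr; congr (_ - _).
    have -> : x + x = (2%:R : R[i]) *: x by rewrite scaler_nat mulr2n.
    rewrite scalerA -[LHS]scale1r; congr (_ *: _).
    by rewrite -(rmorph_nat (real_complex R)) -rmorphM mulVf ?rmorph1// pnatr_eq0.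
  rewrite E1 rnormZ rnormC ger0_norm ?invr_ge0 // => h3.
  have h4 : (2 * d) ^+ 2 <= rnorm ((x - v1) + (x - v2)) ^+ 2.
    by rewrite lerXn2r ?nnegrE ?rnorm_ge0 //; lra.
  have h5 : rnorm (v1 - v2) ^+ 2 = rnorm ((x - v2) - (x - v1)) ^+ 2.
    by congr (rnorm _ ^+ 2); rewrite opprB [RHS]addrC addrA subrK.
  have h6 : rnorm (v1 - v2) ^+ 2 <= (e1 + e2) ^+ 2.
    have e12 : 0 < e1 * e2 by rewrite mulr_gt0.
    move: h4; rewrite h5 (rnormD_sqr (x - v1)) (rnormB_sqr (x - v2)) (ripC (x - v1)).
    by rewrite exprMn (sqrrD e1); lra.
  by move: h6; rewrite ler_sqr ?nnegrE ?rnorm_ge0 //; lra.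
have [m hm] := approx_limit Fex FC.
exists m; split.
  move=> e e0; have [v Fv] := Fex _ e0; exists v; first by case: Fv.
  by rewrite rdistC; have := hm _ _ Fv; rewrite mul1r rdistC.
have nd : rnorm (x - m) <= d.
  apply/ler_addgt0Pr => e e0; have e2 : 0 < e / 2 by rewrite divr_gt0.
  have [v Fv] := Fex _ e2; have [_ Vv h1] := Fv.
  apply: le_trans (rdist_triangle v _ _) _.
  have h2 := hm _ _ Fv; rewrite mul1r in h2.
  have : rnorm (x - v) ^+ 2 <= (d + e / 2) ^+ 2.
    have := mulr_ge0 d0 (ltW e2); rewrite sqrrD; have := sqr_ge0 e; move: h1; rewrite exprMn; lra.
  rewrite ler_sqr ?nnegrE ?rnorm_ge0 //; lra.
have dn w : V w -> d <= rnorm (x - m - w).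
  move=> Vw; apply/ler_addgt0Pr => e e0; have [v Fv] := Fex _ e0; have [_ Vv h1] := Fv.
  have Vwv : V (1 *: w + v) by apply: (Vlin).
  apply: le_trans (dle _ Vwv) _; rewrite scale1r.
  have -> : x - (w + v) = (x - m - w) - (v - m).
    by rewrite opprB addrA (addrAC _ (- w)) subrK -addrA -opprD.
  apply: le_trans (rnormD _ _) _; rewrite rnormN.
  by have := hm _ _ Fv; rewrite mul1r; lra.
have rip0 v : V v -> rip (x - m) v = 0.
  move=> Vv; apply: (@linear_coef_eq0 (rnorm v ^+ 2)); first exact: sqr_ge0.
  move=> c; have Vc : V (c%:C%C *: v + 0) by apply: (Vlin).
  have := le_trans nd (dn _ Vc); rewrite addr0.
  rewrite -ler_sqr ?nnegrE ?rnorm_ge0 // (rnormB_sqr (x - m)) ripZr rnormZ rnormC exprMn -normrX.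
  by rewrite (ger0_norm (sqr_ge0 c)); lra.
move=> v Vv; have Vi : V ('i%C *: v + 0) by apply: (Vlin).
have := rip0 _ Vi; rewrite addr0 -inner_Im; have := rip0 _ Vv; rewrite /rip.
by case: (inner _ _) => a b /= -> ->.
Qed.

(** If f is nonzero at x0, the component n of x0 orthogonal to the kernel spans the
    orthogonal complement of the kernel, and y - (f y / f x0) n is in the kernel for
    every y; so a multiple of n represents f. *)
Lemma riesz (f : H -> R[i]) (M : R) :
  (forall a x y, f (a *: x + y) = a * f x + f y) ->
  (forall x, rnorm (f x) <= M * rnorm x) ->
  exists z, forall x, f x = inner x z.
Proof.
move=> flin fM.
have [f0|/existsNP[x0 fx0]] := pselect (forall x, f x = 0).
  by exists 0 => x; rewrite f0 inner0r.
have f00 : f 0 = 0 by have := flin (-1) 0 0; rewrite scaler0 addr0 mulN1r addNr.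
have [m [mV mo]] : exists m, (forall e : R, 0 < e -> exists2 v, f v = 0 & rnorm (m - v) <= e) /\
            (forall v, f v = 0 -> inner (x0 - m) v = 0).
  by apply: projection => // a y z fy fz; rewrite flin fy fz mulr0 addr0.
have fm : f m = 0.
  apply: (@rdist_small_eq _ _ _ _ `|M|) => e e0; rewrite subr0.
  have [v fv hv] := mV _ e0.
  have -> : f m = f (m - v).
    by have := flin (-1) v m; rewrite fv mulr0 add0r scaleN1r addrC.
  apply: le_trans (fM _) _; apply: le_trans (ler_norm _) _.
  by rewrite normrM ler_wpM2l // ger0_norm ?rnorm_ge0.
set n := x0 - m.
have fn : f n = f x0.
  by have := flin (-1) m x0; rewrite fm mulr0 add0r scaleN1r addrC.
have n0 : inner n n != 0.
  apply/eqP; rewrite inner_sqr => /complexI /eqP; rewrite sqrf_eq0 => /eqP/rnorm0_eq0 n0.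
  by apply: fx0; rewrite -fn n0.
have fx0' : f x0 != 0 by apply/eqP.
exists (conjc (f x0 / inner n n) *: n) => y.
have /mo : f (- (f y / f x0) *: n + y) = 0.
  by rewrite flin fn mulNr divfK // addNr.
rewrite innerC -/n innerDl innerZl => /(congr1 conjc); rewrite conjcK conjc0 => /eqP.
rewrite mulNr addrC subr_eq0 => /eqP h.
by rewrite innerZr conjcK h mulrACA; field; rewrite n0 fx0'.
Qed.

End Projection.

Section Operators.
Variables (R : realType) (H : hilbertType R).
Implicit Types (x y z v w : H) (a : R[i]) (T S : H -> H).

Lemma inner_injr y z : (forall x, inner x y = inner x z) -> y = z.
Proof. by move=> h; apply: rip_inj => x; rewrite !(ripC _ x) /rip h. Qed.

Lemma bounded_operator_gt0 T : bounded_operator T ->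
  exists2 M : R, 0 < M & forall x, rnorm (T x) <= M * rnorm x.
Proof.
move=> [_ [M hM]]; exists (`|M| + 1); first by rewrite ltr_wpDl.
move=> x; apply: le_trans (hM x) _; rewrite ler_wpM2r ?rnorm_ge0 //.
by have := ler_norm M; lra.
Qed.

Lemma adjoint_exists T : bounded_operator T ->
  exists S, bounded_operator S /\ forall x y, inner (T x) y = inner x (S y).
Proof.
move=> bT; have [M M0 hM] := bounded_operator_gt0 bT; have [linT _] := bT.
have /choice[S hS] : forall y, exists z, forall x, inner (T x) y = inner x z.
  move=> y; apply: (@riesz _ _ _ (M * rnorm y)).
    by move=> a x x'; rewrite linT innerDl innerZl.
  move=> x; apply: le_trans (inner_le _ _) _.
  by rewrite mulrAC ler_wpM2r ?rnorm_ge0.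
have hS' x y : inner (T x) y = inner x (S y) by [].
exists S; split=> //; split.
  move=> a y z; apply: inner_injr => x.
  by rewrite -hS' !innerDr !innerZr !hS'.
exists M => y.
have [->|S0] := eqVneq (rnorm (S y)) 0; first by rewrite mulr_ge0 ?rnorm_ge0 // ltW.
have Sp : 0 < rnorm (S y) by rewrite lt_neqAle eq_sym S0 rnorm_ge0.
rewrite -(ler_pM2l Sp) -expr2 -rip_sqr {1}/rip -hS'.
apply: le_trans (rip_le _ _) _.
by rewrite mulrA ler_wpM2r ?rnorm_ge0 // mulrC; exact: hM.
Qed.

Lemma adjointP T : bounded_operator T -> bounded_operator (adjoint T) /\
  forall x y, inner (T x) y = inner x (adjoint T y).
Proof. by move=> /adjoint_exists; apply: getPex. Qed.

End Operators.

(** * Polynomials in an operator *)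

Section OperatorPolynomials.
Variables (R : realType) (H : hilbertType R) (T : H -> H).
Hypothesis linT : linear T.
Implicit Types (x y z v w : H) (a c : R[i]) (p q : {poly R[i]}).

(** Complex coefficients are needed to factor a polynomial into linear factors;
    [opoly] is the case of real coefficients ([opolyE]). *)
Definition cpoly p x : H := \sum_(i < size p) p`_i *: iter i T x.

Lemma cpoly_wide n p x : (size p <= n)%N ->
  cpoly p x = \sum_(i < n) p`_i *: iter i T x.
Proof.
move=> pn; rewrite /cpoly (big_ord_widen_cond n predT (fun i => p`_i *: iter i T x) pn).
rewrite [RHS](bigID (fun i : 'I_n => (i < size p)%N)) /= [X in _ + X]big1 ?addr0 //.
by move=> i; rewrite -leqNgt => ip; rewrite nth_default // scale0r.
Qed.

Lemma cpolyD p q x : cpoly (p + q) x = cpoly p x + cpoly q x.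
Proof.
rewrite !(@cpoly_wide (maxn (size p) (size q))) ?leq_maxl ?leq_maxr ?size_polyD //.
by rewrite -big_split; apply: eq_bigr => i _; rewrite coefD scalerDl.
Qed.

Lemma cpolyC c x : cpoly c%:P x = c *: x.
Proof.
by rewrite (@cpoly_wide 1) ?size_polyC ?leq_b1 // big_ord1 coefC.
Qed.

Lemma cpolyMX p x : cpoly (p * 'X) x = cpoly p (T x).
Proof.
rewrite (@cpoly_wide (size p).+1); last first.
  by apply: leq_trans (size_polyMleq _ _) _; rewrite size_polyX addn2.
rewrite big_ord_recl coefMX eqxx scale0r add0r /cpoly.
by apply: eq_bigr => i _; rewrite coefMX lift0 iterSr.
Qed.

Lemma cpoly_linear p : linear (cpoly p).
Proof.
elim/poly_ind: p => [|p c IH] a x y.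
  by rewrite /cpoly size_poly0 !big_ord0 scaler0 addr0.
rewrite !cpolyD !cpolyC !cpolyMX linT IH !scalerDr !scalerA (mulrC c).
by rewrite addrACA.
Qed.

Lemma cpoly_comm p x : cpoly p (T x) = T (cpoly p x).
Proof.
elim/poly_ind: p x => [|p c IH] x.
  by rewrite /cpoly size_poly0 !big_ord0 (lin0 linT).
by rewrite !cpolyD !cpolyC !cpolyMX (linD linT) (linZ linT) IH.
Qed.

Lemma cpolyM p q x : cpoly (p * q) x = cpoly p (cpoly q x).
Proof.
elim/poly_ind: p x => [|p c IH] x.
  by rewrite mul0r /cpoly size_poly0 !big_ord0.
rewrite mulrDl -mulrA (mulrC 'X) mulrA !cpolyD !cpolyMX IH cpoly_comm.
congr (_ + _); elim/poly_ind: q x {IH} => [|q d IH] x.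
  by rewrite mulr0 -(polyC0 R[i]) !cpolyC scalerA mulr0.
by rewrite mulrDr mulrA !cpolyD !cpolyMX IH -polyCM !cpolyC scalerDr scalerA.
Qed.

Lemma cpolyX x : cpoly 'X x = T x.
Proof. by rewrite -['X]mul1r cpolyMX cpolyC scale1r. Qed.

Lemma opolyE (p : {poly R}) x : opoly p T x = cpoly (map_poly (real_complex R) p) x.
Proof.
rewrite /opoly fct_sumE /cpoly size_map_poly.
by apply: eq_bigr => i _; rewrite coef_map.
Qed.

Lemma opolyD (p q : {poly R}) x : opoly (p + q) T x = opoly p T x + opoly q T x.
Proof. by rewrite !opolyE rmorphD cpolyD. Qed.

Lemma opolyM (p q : {poly R}) x : opoly (p * q) T x = opoly p T (opoly q T x).
Proof. by rewrite !opolyE rmorphM cpolyM. Qed.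

Lemma opolyC (c : R) x : opoly c%:P T x = c%:C%C *: x.
Proof. by rewrite !opolyE map_polyC cpolyC. Qed.

Lemma opolyX x : opoly 'X T x = T x.
Proof. by rewrite !opolyE map_polyX cpolyX. Qed.

Lemma opolyB (p q : {poly R}) x : opoly (p - q) T x = opoly p T x - opoly q T x.
Proof.
rewrite opolyD -mulN1r -polyCN opolyM opolyC.
by rewrite rmorphN rmorph1 scaleN1r.
Qed.

Lemma opoly_linear (p : {poly R}) : linear (opoly p T).
Proof. by move=> a x y; rewrite !opolyE cpoly_linear. Qed.

Lemma opoly_self_adjoint (p : {poly R}) :
  (forall x y, inner (T x) y = inner x (T y)) ->
  forall x y, inner (opoly p T x) y = inner x (opoly p T y).
Proof.
move=> saT; elim/poly_ind: p => [|p c IH] x y.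
  by rewrite -(polyC0 R) !opolyC rmorph0 !scale0r inner0l inner0r.
rewrite !opolyD !opolyM !opolyX !opolyC innerDl innerDr IH saT innerZl innerZr conjc_real.
by congr (inner _ _ + _); rewrite !opolyE cpoly_comm.
Qed.

Lemma opoly_bounded (p : {poly R}) : bounded_operator T -> bounded_operator (opoly p T).
Proof.
move=> bT; split; first exact: opoly_linear.
have [M M0 hM] := bounded_operator_gt0 bT.
elim/poly_ind: p => [|p c [N hN]].
  by exists 0 => x; rewrite -(polyC0 R) opolyC rmorph0 scale0r mul0r rnorm0.
exists (`|N| * M + `|c|) => x.
rewrite opolyD opolyM opolyX opolyC mulrDl; apply: le_trans (rnormD _ _) _.
rewrite rnormZ rnormC lerD2r; apply: le_trans (hN _) _.
rewrite -mulrA; apply: le_trans (_ : `|N| * rnorm (T x) <= _).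
  by rewrite ler_wpM2r ?rnorm_ge0 ?ler_norm.
by rewrite ler_wpM2l.
Qed.

End OperatorPolynomials.

(** * Polynomials of a self-adjoint operator are controlled on the spectrum *)

Section SpectralPositivity.
Variables (R : realType) (H : hilbertType R).
Implicit Types (x y z u v w : H) (a c : R[i]) (T P Q : H -> H).

Definition self_adjoint T := forall x y, inner (T x) y = inner x (T y).
(** For a bounded T this fails exactly when 0 is an approximate eigenvalue of T. *)
Definition bounded_below T := exists2 c : R, 0 < c & forall x, c * rnorm x <= rnorm (T x).

Lemma ripJ T x y : self_adjoint T -> rip (T x) y = rip x (T y).
Proof. by move=> saT; rewrite /rip saT. Qed.

Lemma unit_vector x : x != 0 -> exists u : H, rnorm u = 1 /\ x = (rnorm x)%:C%C *: u.
Proof.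
move=> x0; have n0 : rnorm x != 0 by apply: contra_neq x0 => /rnorm0_eq0.
exists ((rnorm x)^-1%:C%C *: x); split.
  by rewrite rnormZ rnormC ger0_norm ?invr_ge0 ?rnorm_ge0 // mulVf.
by rewrite scalerA -rmorphM divff // rmorph1 scale1r.
Qed.

(** The infimum m of the quadratic form on the unit sphere is an approximate
    eigenvalue.  Indeed S = Q - m is positive with norm at most L, so that
    ||Sx||^2 <= L <Sx, x>; a lower bound c ||x|| <= ||Sx|| would thus raise the infimum
    by c^2 / L. *)
Lemma numerical_lower_bound_spectral Q u : bounded_operator Q -> self_adjoint Q ->
  rnorm u = 1 ->
  exists m : R, (forall x, m * rnorm x ^+ 2 <= rip (Q x) x) /\
    ~ bounded_below (fun x => Q x - m%:C%C *: x).
Proof.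
move=> bQ saQ u1; have [linQ _] := bQ; have [M M0 hM] := bounded_operator_gt0 bQ.
pose D := [set rip (Q x) x | x in [set x : H | rnorm x = 1]].
have D0 : D !=set0 by exists (rip (Q u) u), u.
have ripM x : - (M * rnorm x ^+ 2) <= rip (Q x) x.
  have := rip_le (- Q x) x; rewrite ripNl rnormN.
  have := ler_wpM2r (rnorm_ge0 x) (hM x); rewrite -mulrA -expr2; lra.
have Dlb : has_lbound D.
  by exists (- M) => _ [x x1 <-]; have := ripM x; rewrite x1 expr1n mulr1.
pose m := inf D; exists m.
have mP x : m * rnorm x ^+ 2 <= rip (Q x) x.
  have [->|/unit_vector[v [v1 ->]]] := eqVneq x 0.
    by rewrite rnorm0 expr0n mulr0 (lin0 linQ) /rip inner0l.
  rewrite (linZ linQ) ripZl ripZr rnormZ rnormC v1 mulr1 real_normK ?num_real //.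
  rewrite mulrA -expr2 mulrC ler_wpM2l ?sqr_ge0 //.
  by apply: ge_inf => //; exists v.
have [S SE] : exists S : H -> H, forall x, S x = Q x - m%:C%C *: x by eexists.
split=> // -[c c0 hc'].
have hc x : c * rnorm x <= rnorm (S x) by rewrite SE.
have ripS x y : rip (S x) y = rip x (S y).
  by rewrite !SE !ripE (ripJ _ _ saQ).
have S0 x : 0 <= rip (S x) x by rewrite !SE !ripE rip_sqr subr_ge0.
have [L L0 hL] : exists2 L : R, 0 < L & forall x, rnorm (S x) <= L * rnorm x.
  exists (M + `|m|); first by rewrite ltr_wpDr.
  move=> x; rewrite SE; apply: le_trans (rnormD _ _) _.
  by rewrite rnormN rnormZ rnormC mulrDl lerD2r.
have linS : linear S.
  move=> a x y; rewrite !SE linQ scalerDr opprD addrACA scalerBr; congr (_ - _ + _).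
  by rewrite !scalerA mulrC.
have key x : rnorm (S x) ^+ 2 <= L * rip (S x) x.
  (* The point x - Sx / L gives <Sx, x> - ||Sx||^2 / L >= 0: the terms in 1 / L^2
     absorb half of the cross terms because S has norm at most L. *)
  have := S0 (x - (L^-1)%:C%C *: S x).
  rewrite (linB linS) (linZ linS) !ripE (ripS (S x) x) rip_sqr.
  have h : rip (S (S x)) (S x) <= L * rnorm (S x) ^+ 2.
    by apply: le_trans (rip_le _ _) _; rewrite expr2 mulrA ler_wpM2r ?rnorm_ge0.
  have h' : L^-1 * (L^-1 * rip (S (S x)) (S x)) <= L^-1 * rnorm (S x) ^+ 2.
    by rewrite ler_wpM2l ?invr_ge0 ?(ltW L0) // mulrC ler_pdivrMr // mulrC.
  have h'' : 0 <= rip (S x) x - L^-1 * rnorm (S x) ^+ 2 -> rnorm (S x) ^+ 2 <= L * rip (S x) x.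
    by rewrite subr_ge0 mulrC ler_pdivrMr // mulrC.
  move=> h3; apply: h''; lra.
have [||_ [x x1 <-]] := @inf_adherent _ D (c ^+ 2 / L).
- by rewrite divr_gt0 ?exprn_gt0.
- by split.
rewrite -/m ltNge => /negP; apply.
have := key x; have := hc x; rewrite x1 mulr1 => h1 h2.
have : c ^+ 2 <= rnorm (S x) ^+ 2 by rewrite lerXn2r ?nnegrE ?rnorm_ge0 // ltW.
move=> /le_trans/(_ h2); rewrite mulrC -ler_pdivrMr // !SE !ripE rip_sqr x1; lra.
Qed.

(** A product of operators that are bounded below is bounded below, so one of the
    linear factors of q(P) has to fail this. *)
Lemma not_bounded_below_root P (q : {poly R[i]}) : linear P -> q != 0 ->
  ~ bounded_below (cpoly P q) ->
  exists2 r, root q r & ~ bounded_below (fun x => P x - r *: x).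
Proof.
move=> linP q0 hq; apply: contra_notP hq => hr.
have hr' r : root q r -> bounded_below (fun x => P x - r *: x).
  by move=> rr; apply: contrapT => h; apply: hr; exists r.
have [s qE] := closed_field_poly_normal q.
have l0 : lead_coef q != 0 by rewrite lead_coef_eq0.
have {hr} : forall r, r \in s -> bounded_below (fun x => P x - r *: x).
  move=> r rs; apply: hr'; rewrite qE rootZ // root_prod_XsubC //.
rewrite qE => hs.
have [c c0 hc] : bounded_below (cpoly P (\prod_(z <- s) ('X - z%:P))).
  elim: s hs {qE} => [|r s IH] hs.
    by exists 1 => // x; rewrite big_nil cpolyC scale1r mul1r.
  have [c c0 hc] : bounded_below (cpoly P (\prod_(z <- s) ('X - z%:P))).
    by apply: IH => r' rs; apply: hs; rewrite inE rs orbT.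
  have [d d0 hd] := hs r (mem_head _ _).
  exists (d * c); first exact: mulr_gt0.
  move=> x; rewrite big_cons cpolyM // cpolyD -polyCN cpolyC cpolyX scaleNr.
  by apply: le_trans (hd _); rewrite -mulrA ler_wpM2l ?(ltW d0).
exists (rnorm (lead_coef q) * c).
  rewrite mulr_gt0 // lt_neqAle rnorm_ge0 andbT eq_sym.
  by apply: contra_neq l0 => /rnorm0_eq0.
move=> x; rewrite -mul_polyC cpolyM // cpolyC rnormZ -mulrA.
by rewrite ler_wpM2l ?rnorm_ge0.
Qed.

Lemma rnorm_ge_Im (w : R[i]) : `|complex.Im w| <= rnorm w.
Proof.
by rewrite /rnorm normc_def /= -[leLHS]sqrtr_sqr ler_wsqrtr // lerDr sqr_ge0.
Qed.

(** Since <Px, x> is real, the imaginary part b of r gives |b| ||x|| <= ||(P - r)x||,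
    hence b = 0; and a bounded inverse of P - r would bound it below. *)
Lemma not_bounded_below_spectrum P r : self_adjoint P ->
  ~ bounded_below (fun x => P x - r *: x) ->
  exists2 s : R, r = s%:C%C & spectrum P r.
Proof.
move=> saP hr; exists (complex.Re r).
  case: r hr => s b /= hr; have [-> //|b0] := eqVneq b 0.
  case: hr; exists `|b|; first by rewrite normr_gt0.
  move=> x; have [->|x0] := eqVneq (rnorm x) 0; first by rewrite mulr0 rnorm_ge0.
  have xp : 0 < rnorm x by rewrite lt_neqAle eq_sym x0 rnorm_ge0.
  rewrite -(ler_pM2r xp) -mulrA -expr2.
  have ImP : complex.Im (inner (P x) x) = 0.
    have : inner (P x) x = conjc (inner (P x) x) by rewrite -innerC saP.
    by case: (inner _ _) => u v [] /eqP; rewrite -addr_eq0 -mulr2n mulrn_eq0 => /eqP.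
  have := inner_le (P x - (s +i* b)%C *: x) x; apply: le_trans.
  rewrite innerDl innerNl innerZl inner_sqr.
  case: (inner (P x) x) ImP => u v /= ->.
  apply: le_trans (rnorm_ge_Im _); rewrite /= mulr0 !add0r normrN normrM.
  by rewrite (ger0_norm (sqr_ge0 _)).
move=> [S [bS KS _]]; apply: hr.
have [M M0 hM] := bounded_operator_gt0 bS; exists M^-1; first by rewrite invr_gt0.
by move=> x; rewrite mulrC ler_pdivrMr // mulrC -{1}(KS x); exact: hM.
Qed.

(** The infimum m of the quadratic form of p(P) on the unit sphere is a value of p on
    the spectrum of P.  When p - m is the zero polynomial any point of the spectrum
    will do, and one exists by [numerical_lower_bound_spectral] for P itself. *)
Lemma opoly_ge0 P (p : {poly R}) x : bounded_operator P -> self_adjoint P ->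
  (forall s : R, spectrum P s%:C%C -> 0 <= p.[s]) -> 0 <= rip (opoly p P x) x.
Proof.
move=> bP saP hp; have [linP _] := bP.
rewrite leNgt; apply/negP => px.
have x0 : x != 0.
  by apply: contraTneq px => ->; rewrite /rip inner0r ltxx.
have [u [u1 _]] := unit_vector x0.
have [m [hm hb]] := numerical_lower_bound_spectral (opoly_bounded linP p bP)
  (opoly_self_adjoint linP p saP) u1.
have m0 : m < 0.
  have : m * rnorm x ^+ 2 < 0 by apply: le_lt_trans px.
  by rewrite pmulr_llt0 // exprn_gt0 // lt_neqAle rnorm_ge0 andbT eq_sym;
     apply: contra_neq x0 => /rnorm0_eq0.
have [s ss qs] : exists2 s : R, spectrum P s%:C%C & (p - m%:P).[s] = 0.
  have [q0|q0] := eqVneq (p - m%:P) 0.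
    have [m' [_ /(not_bounded_below_spectrum saP)[_ _ sm]]] :=
      numerical_lower_bound_spectral bP saP u1.
    by exists m'; [exact: sm | rewrite q0 horner0].
  have [||r rr] := @not_bounded_below_root P (map_poly (real_complex R) (p - m%:P)) linP.
  - by rewrite map_poly_eq0.
  - apply: contra_not hb => -[c c0 hc]; exists c => // y.
    by apply: le_trans (hc y) _; rewrite -opolyE opolyB // opolyC.
  move=> /(not_bounded_below_spectrum saP)[s rs sr]; exists s; first by rewrite -rs.
  by move: rr; rewrite rs /root horner_map => /eqP/complexI.
by move: qs (hp s ss); rewrite hornerD hornerN hornerC; lra.
Qed.

(** [opoly_ge0] for the polynomial M^2 - p^2, as p(P) is self-adjoint. *)
Lemma opoly_norm_le P (p : {poly R}) (M : R) x : bounded_operator P -> self_adjoint P ->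
  0 <= M -> (forall s : R, spectrum P s%:C%C -> `|p.[s]| <= M) ->
  rnorm (opoly p P x) <= M * rnorm x.
Proof.
move=> bP saP M0 hp; have [linP _] := bP.
have := @opoly_ge0 P ((M ^+ 2)%:P - p * p) x bP saP.
rewrite opolyB // opolyC // opolyM // ripDl ripNl ripZl rip_sqr.
have -> : rip (opoly p P (opoly p P x)) x = rnorm (opoly p P x) ^+ 2.
  by rewrite (ripJ _ _ (opoly_self_adjoint linP p saP)) rip_sqr.
rewrite subr_ge0 -exprMn ler_sqr ?nnegrE ?mulr_ge0 ?rnorm_ge0 //; apply.
move=> s /hp hs; rewrite hornerD hornerN hornerC hornerM subr_ge0 -expr2 -real_normK ?num_real //.
by rewrite ler_sqr ?nnegrE.
Qed.

End SpectralPositivity.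

(** * Location of the spectrum of a positive operator *)

Section SpectrumLocation.
Variables (R : realType) (H : hilbertType R).
Implicit Types (x y z u v w : H) (a c : R[i]) (T P Q : H -> H).

(** The range is dense, because a vector orthogonal to it is in the kernel; and it is
    closed, because the lower bound makes preimages of a convergent family converge. *)
Lemma self_adjoint_bounded_below_inv T : bounded_operator T -> self_adjoint T ->
  bounded_below T -> exists S, [/\ bounded_operator S, cancel T S & cancel S T].
Proof.
move=> bT saT [c c0 hc]; have [linT _] := bT; have [M M0 hM] := bounded_operator_gt0 bT.
have Tinj x y : T x = T y -> x = y.
  move=> Txy; apply/eqP; rewrite -subr_eq0; apply/eqP/rnorm0_eq0/eqP.
  rewrite eq_le rnorm_ge0 andbT -(ler_pM2l c0) mulr0; apply: le_trans (hc _) _.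
  by rewrite (linB linT) Txy subrr rnorm0.
have surj y : exists x, T x = y.
  have [m [mV mo]] : exists m, (forall e : R, 0 < e ->
      exists2 v, (exists z, v = T z) & rnorm (m - v) <= e) /\
      (forall v, (exists z, v = T z) -> inner (y - m) v = 0).
    apply: projection; first by exists 0; rewrite (lin0 linT).
    by move=> a _ _ [z ->] [z' ->]; exists (a *: z + z'); rewrite linT.
  have ym : y = m.
    apply: Tinj; apply: rip_inj => z; apply/eqP; rewrite -subr_eq0 -ripNl -ripDl.
    by rewrite -(linB linT) (ripJ _ _ saT) /rip mo //; exists z.
  pose F (e : R) z := rnorm (y - T z) <= e.
  have Fex (e : R) : 0 < e -> exists z, F e z.
    by move=> /mV[_ [z ->]]; rewrite -ym; exists z.
  have [|l hl] := approx_limit (C := c^-1) Fex.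
    move=> e1 e2 z1 z2 h1 h2; rewrite mulrC ler_pdivlMr // mulrC.
    apply: le_trans (hc _) _; rewrite (linB linT).
    apply: le_trans (rdist_triangle y _ _) _; rewrite rdistC; exact: lerD.
  exists l; apply: (@rdist_small_eq _ _ _ _ (M * c^-1 + 1)) => e e0.
  have [z Fz] := Fex _ e0; apply: le_trans (rdist_triangle (T z) _ _) _.
  rewrite mulrDl mul1r; apply: lerD; last by rewrite rdistC.
  rewrite -(linB linT); apply: le_trans (hM _) _.
  by rewrite -mulrA ler_wpM2l ?(ltW M0) // rdistC; apply: hl.
have /choice[S TS] := surj; exists S; split=> //.
- split; first by move=> a x y; apply: Tinj; rewrite linT !TS.
  by exists c^-1 => y; rewrite mulrC ler_pdivlMr // mulrC -{2}(TS y).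
- by move=> x; apply: Tinj; rewrite TS.
Qed.

Lemma spectrum_positive P : bounded_operator P -> self_adjoint P ->
  (forall x, 0 <= rip (P x) x) ->
  exists2 K : R, 0 < K & forall s : R, spectrum P s%:C%C -> 0 <= s <= K.
Proof.
move=> bP saP posP; have [linP _] := bP; have [M M0 hM] := bounded_operator_gt0 bP.
exists M => // s ss; apply: contrapT => hs; apply: ss.
apply: self_adjoint_bounded_below_inv.
- split.
    move=> a x y; rewrite !fctE linP scalerDr opprD addrACA scalerBr; congr (_ - _ + _).
    by rewrite !scalerA mulrC.
  exists (M + `|s|) => x; rewrite !fctE; apply: le_trans (rnormD _ _) _.
  by rewrite rnormN rnormZ rnormC mulrDl lerD2r.
- move=> x y; rewrite !fctE innerDl innerDr innerNl innerNr innerZl innerZr conjc_real.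
  by rewrite saP.
have [s0|s0] := ltP s 0.
  exists (- s); first by rewrite oppr_gt0.
  move=> x; rewrite !fctE; have [->|x0] := eqVneq (rnorm x) 0; first by rewrite mulr0 rnorm_ge0.
  have xp : 0 < rnorm x by rewrite lt_neqAle eq_sym x0 rnorm_ge0.
  rewrite -(ler_pM2r xp) -mulrA -expr2; apply: le_trans (rip_le _ _).
  by rewrite !ripE rip_sqr; have := posP x; lra.
have sM : M < s by rewrite ltNge; apply/negP => sM; apply: hs; rewrite s0 sM.
exists (s - M); first by rewrite subr_gt0.
move=> x; rewrite !fctE; have := rdist_triangle (P x) (s%:C%C *: x) 0.
rewrite !subr0 rnormZ rnormC ger0_norm // rdistC; have := hM x; lra.
Qed.

End SpectrumLocation.

(** * Uniform approximation of real powers by polynomials *)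

Section Bernstein.
Variable R : realType.
Implicit Types (x y e : R).

Definition bernstein_weight n k x : R := 'C(n, k)%:R * (x ^+ k * (1 - x) ^+ (n - k)).

Lemma bernstein_weight_ge0 n k x : 0 <= x <= 1 -> 0 <= bernstein_weight n k x.
Proof.
by move=> /andP[x0 x1]; rewrite mulr_ge0 // mulr_ge0 // exprn_ge0 // subr_ge0.
Qed.

Lemma bernstein_mean1 n x : \sum_(k < n.+1) bernstein_weight n k x = 1.
Proof.
transitivity ((1 - x + x) ^+ n); last by rewrite subrK expr1n.
rewrite exprDn.
apply: eq_bigr => i _; rewrite /bernstein_weight -[RHS]mulr_natl; congr (_ * _).
exact: mulrC.
Qed.

(** Absorption identity (k+1) C(n+1, k+1) = (n+1) C(n, k), in the form that computes
    the moments of the binomial distribution one degree at a time. *)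
Lemma bernstein_mean_mul n x (g : nat -> R) :
  \sum_(k < n.+2) k%:R * g k * bernstein_weight n.+1 k x =
  n.+1%:R * x * \sum_(k < n.+1) g k.+1 * bernstein_weight n k x.
Proof.
rewrite big_ord_recl !mul0r add0r mulr_sumr; apply: eq_bigr => i _.
rewrite lift0 /bernstein_weight subSS exprS.
have h : n.+1%:R * 'C(n, i)%:R = i.+1%:R * 'C(n.+1, i.+1)%:R :> R.
  by rewrite -!natrM (mul_bin_diag n.+1 i).
transitivity ((i.+1%:R * 'C(n.+1, i.+1)%:R) * (g i.+1 * (x * (x ^+ i * (1 - x) ^+ (n - i))))).
  by ring.
by rewrite -h; ring.
Qed.

Lemma bernstein_variance n x :
  \sum_(k < n.+2) (k%:R / n.+1%:R - x) ^+ 2 * bernstein_weight n.+1 k x = x * (1 - x) / n.+1%:R.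
Proof.
have n0 : n.+1%:R != 0 :> R by rewrite pnatr_eq0.
have m1 : \sum_(k < n.+2) k%:R * 1 * bernstein_weight n.+1 k x = n.+1%:R * x.
  rewrite (bernstein_mean_mul n x (fun=> 1)).
  by under eq_bigr => i _ do rewrite mul1r; rewrite bernstein_mean1 mulr1.
have m0 : \sum_(k < n.+1) k%:R * 1 * bernstein_weight n k x = n%:R * x.
  case: n {n0 m1} => [|n]; first by rewrite big_ord1 !mul0r.
  rewrite (bernstein_mean_mul n x (fun=> 1)).
  by under eq_bigr => i _ do rewrite mul1r; rewrite bernstein_mean1 mulr1.
have m2 : \sum_(k < n.+2) k%:R * k%:R * bernstein_weight n.+1 k x =
    n.+1%:R * x * (n%:R * x + 1).
  rewrite (bernstein_mean_mul n x (fun k => k%:R)); congr (_ * _).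
  rewrite -m0 -[X in _ + X](bernstein_mean1 n x) -big_split; apply: eq_bigr => i _ /=.
  by rewrite -natr1; ring.
have -> : \sum_(k < n.+2) (k%:R / n.+1%:R - x) ^+ 2 * bernstein_weight n.+1 k x =
  n.+1%:R ^- 2 * (\sum_(k < n.+2) k%:R * k%:R * bernstein_weight n.+1 k x)
  - 2 * x / n.+1%:R * (\sum_(k < n.+2) k%:R * 1 * bernstein_weight n.+1 k x)
  + x ^+ 2 * (\sum_(k < n.+2) bernstein_weight n.+1 k x).
  rewrite !mulr_sumr -sumrN -!big_split; apply: eq_bigr => i _ /=.
  by field.
rewrite m1 m2 bernstein_mean1 -natr1 in n0 *; field.
by rewrite addrC.
Qed.

Definition approximable (K : R) (f : R -> R) :=
  forall e : R, 0 < e -> exists p : {poly R}, forall x, 0 <= x <= K -> `|p.[x] - f x| <= e.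

(** The hypothesis is uniform continuity in the only form that the proof uses: with
    the Bernstein polynomial of degree n+1, the quadratic term is averaged into the
    variance x(1 - x)/(n+1) and so tends to 0. *)
Lemma weierstrass (f : R -> R) :
  (forall e : R, 0 < e -> exists C : R, forall x y, 0 <= x <= 1 -> 0 <= y <= 1 ->
    `|f x - f y| <= e + C * (x - y) ^+ 2) ->
  approximable 1 f.
Proof.
move=> hf e e0; have e2 : 0 < e / 2 by rewrite divr_gt0.
have [C hC] := hf _ e2.
have C0 : 0 < `|C| + 1 by rewrite ltr_wpDl.
have [n _ /(_ n (leqnn n))] := near_infty_natSinv_lt (PosNum (divr_gt0 e2 C0)).
rewrite /= ltr_pdivlMr // => hn.
pose p : {poly R} := \sum_(k < n.+2)
  (f (k%:R / n.+1%:R) * 'C(n.+1, k)%:R)%:P * ('X^k * (1 - 'X) ^+ (n.+1 - k)).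
exists p => x x01.
have -> : p.[x] = \sum_(k < n.+2) f (k%:R / n.+1%:R) * bernstein_weight n.+1 k x.
  rewrite horner_sum; apply: eq_bigr => i _.
  by rewrite !(hornerE, horner_exp) /bernstein_weight /= ?mulrA.
rewrite -[f x]mulr1 -[X in f x * X](bernstein_mean1 n.+1 x) mulr_sumr -sumrB.
apply: le_trans (ler_norm_sum _ _ _) _.
apply: (@le_trans _ _ (\sum_(k < n.+2) (e / 2 * bernstein_weight n.+1 k x +
    C * ((k%:R / n.+1%:R - x) ^+ 2 * bernstein_weight n.+1 k x)))).
  apply: ler_sum => i _; rewrite -mulrBl normrM (ger0_norm (bernstein_weight_ge0 _ _ x01)).
  rewrite [C * _]mulrA -mulrDl ler_wpM2r ?bernstein_weight_ge0 //. apply: hC => //.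
  by rewrite divr_ge0 //= ler_pdivrMr // mul1r ler_nat -ltnS.
rewrite big_split /= -!mulr_sumr bernstein_mean1 bernstein_variance.
have xx : 0 <= x * (1 - x) <= 1 by move: x01 => /andP[x0 x1]; nra.
have : C * (x * (1 - x) / n.+1%:R) <= `|C| * n.+1%:R^-1.
  apply: le_trans (ler_norm _) _; rewrite normrM ler_wpM2l // ger0_norm.
    by rewrite ler_piMl ?invr_ge0 //; case/andP: xx.
  by rewrite divr_ge0 //; case/andP: xx.
move: hn; rewrite (mulrDr n.+1%:R^-1) !mulr1 (mulrC _ `|C|) => h1 h2.
have : 0 <= n.+1%:R^-1 :> R by rewrite invr_ge0.
move: h1 h2; move: (n.+1%:R^-1) => ? ? ?. lra.
Qed.

(** With u = y / (y + h) and v = h / (y + h), both in [0, 1], u <= u^s and v <= v^s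
    add up to 1 <= u^s + v^s. *)
Lemma powR_subadditive (s y h : R) : 0 <= s -> s <= 1 -> 0 <= y -> 0 <= h ->
  (y + h) `^ s <= y `^ s + h `^ s.
Proof.
move=> s0 s1 y0 h0; have [|x0] := leP (y + h) 0.
  move=> x0; have -> : y = 0 by lra. have -> : h = 0 by lra.
  by rewrite addr0 lerDl powR_ge0.
have frac z : 0 <= z -> z <= y + h -> z / (y + h) * (y + h) `^ s <= z `^ s.
  move=> z0 zx; have [->|zn0] := eqVneq z 0; first by rewrite !mul0r powR_ge0.
  have zp : 0 < z by rewrite lt_neqAle eq_sym zn0.
  have {2}-> : z = z / (y + h) * (y + h) by rewrite divfK // gt_eqF.
  rewrite powRM ?divr_ge0 ?(ltW x0) // ler_wpM2r ?powR_ge0 // ger1_powR //.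
  by rewrite divr_gt0 //= ler_pdivrMr // mul1r.
have := frac _ y0; have := frac _ h0.
rewrite lerDl lerDr => /(_ y0) hh /(_ h0) hy; apply: le_trans (lerD hy hh).
by rewrite -mulrDl -mulrDl divff ?mul1r // gt_eqF.
Qed.

Lemma powR_hoelder (s x y : R) : 0 <= s -> s <= 1 -> 0 <= x -> 0 <= y ->
  `|x `^ s - y `^ s| <= `|x - y| `^ s.
Proof.
move=> s0 s1; wlog xy : x y / y <= x.
  move=> W x0 y0; have [yx|/ltW xy] := leP y x; first exact: W.
  by rewrite distrC (distrC x); apply: W.
move=> x0 y0; rewrite !ger0_norm ?subr_ge0 ?ge0_ler_powR //.
have xy0 : 0 <= x - y by rewrite subr_ge0.
by have := powR_subadditive s0 s1 y0 xy0; rewrite (addrC y) subrK; lra.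
Qed.

Lemma approximable_powR01 (s : R) : 0 <= s -> s <= 1 -> approximable 1 (fun x => x `^ s).
Proof.
move=> s0 s1; apply: weierstrass => e e0.
have [->|sn0] := eqVneq s 0.
  by exists 0 => x y _ _; rewrite !powRr0 subrr normr0 mul0r addr0 ltW.
have sp : 0 < s by rewrite lt_neqAle eq_sym sn0.
pose d := e `^ s^-1.
have d0 : 0 < d by rewrite powR_gt0.
exists (d ^- 2) => x y /andP[x0 x1] /andP[y0 y1].
apply: le_trans (powR_hoelder s0 s1 x0 y0) _.
have [xyd|dxy] := leP `|x - y| d.
  apply: ler_wpDr; first by rewrite mulr_ge0 ?invr_ge0 ?sqr_ge0.
  have : `|x - y| `^ s <= d `^ s by rewrite ge0_ler_powR ?nnegrE ?(ltW d0).
  by rewrite -powRrM mulVf // powRr1 // ltW.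
apply: ler_wpDl; first exact: ltW.
have h1 : `|x - y| `^ s <= 1.
  have : `|x - y| `^ s <= 1 `^ s; last by rewrite powR1.
  rewrite ge0_ler_powR ?nnegrE // ler_norml; apply/andP; split; lra.
apply: le_trans h1 _; rewrite -(@real_normK _ (x - y)) ?num_real //.
rewrite mulrC ler_pdivlMr ?exprn_gt0 // mul1r.
by rewrite ler_sqr ?nnegrE ?(ltW d0) // ltW.
Qed.

(** Exponents in [0, 1] are handled by Bernstein polynomials and rescaling to [0, 1];
    multiplication by x raises the exponent by one. *)
Lemma approximable_powR (K s : R) : 0 < K -> 0 <= s -> approximable K (fun x => x `^ s).
Proof.
move=> K0 s0.
have small r : 0 <= r -> r <= 1 -> approximable K (fun x => x `^ r).
  move=> r0 r1 e e0; have Kr : 0 < K `^ r by rewrite powR_gt0.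
  have [p hp] := approximable_powR01 r0 r1 (divr_gt0 e0 Kr).
  exists ((K `^ r) *: (p \Po (K^-1 *: 'X))) => x /andP[x0 xK].
  have xK1 : 0 <= x / K <= 1 by rewrite divr_ge0 ?(ltW K0) //= ler_pdivrMr // mul1r.
  rewrite !(hornerE, horner_comp) (mulrC _ x).
  have -> : x `^ r = K `^ r * (x / K) `^ r.
    by rewrite -powRM ?(ltW K0) ?(andP xK1).1 // mulrC divfK // gt_eqF.
  by rewrite -mulrBr normrM gtr0_norm // [leLHS]mulrC -ler_pdivlMr //; apply: hp.
have : exists n : nat, s <= n%:R.
  by exists (Num.bound s); apply/ltW/archi_boundP.
move=> [n]; elim: n s s0 => [|n IH] s s0 sn; first by apply: small => //; lra.
have [s1|s1] := leP s 1; first exact: small.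
have s10 : 0 <= s - 1 by lra.
move=> e e0; have [|p hp] := IH _ s10 _ _ (divr_gt0 e0 K0).
  by move: sn; rewrite -natr1; lra.
exists (p * 'X) => x x0K; have := hp x x0K; have /andP[x0 xK] := x0K.
have -> : x `^ s = x `^ (s - 1) * x.
  by rewrite mulrC mulr_powRB1 //; lra.
rewrite !hornerE -mulrBl normrM (ger0_norm x0) ler_pdivlMr // => h.
by apply: le_trans h; rewrite ler_wpM2l.
Qed.
End Bernstein.

(** * Operator norm and numerical radius of bounded operators *)

Section Bounds.
Variables (R : realType) (H : hilbertType R).
Implicit Types (x y z u v w : H) (a c : R[i]) (T S P Q : H -> H).

Lemma opnorm_le T (M : R) : 0 <= M -> (forall x, rnorm (T x) <= M * rnorm x) ->
  opnorm T <= M.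
Proof.
move=> M0 hM; have [[r Dr]|D0] := pselect ([set rnorm (T x) | x in [set x | rnorm x = 1]] !=set0).
  by apply: ge_sup; [exists r|move=> _ [x /= x1 <-]; rewrite -[M]mulr1 -x1].
by rewrite /opnorm (_ : [set _ | _ in _] = set0) ?sup0 //; apply/nonemptyPn.
Qed.

Lemma le_opnorm T x : bounded_operator T -> rnorm (T x) <= opnorm T * rnorm x.
Proof.
move=> bT; have [linT _] := bT; have [M M0 hM] := bounded_operator_gt0 bT.
have [->|/unit_vector[v [v1 ->]]] := eqVneq x 0; first by rewrite (lin0 linT) rnorm0 mulr0.
rewrite (linZ linT) !rnormZ v1 mulr1 mulrC ler_wpM2r ?rnorm_ge0 //.
apply: ub_le_sup; last by exists v.
by exists M => _ [y /= y1 <-]; rewrite -[M]mulr1 -y1.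
Qed.

Lemma opnorm_ge0 T : bounded_operator T -> 0 <= opnorm T.
Proof.
move=> bT; have [[r Dr]|D0] := pselect ([set rnorm (T x) | x in [set x | rnorm x = 1]] !=set0).
  case: Dr => x /= x1 _; have := le_opnorm x bT; rewrite x1 mulr1.
  by apply: le_trans; exact: rnorm_ge0.
by rewrite /opnorm (_ : [set _ | _ in _] = set0) ?sup0 //; apply/nonemptyPn.
Qed.

Lemma numradius_le T (M : R) : 0 <= M ->
  (forall x, rnorm x = 1 -> rnorm (inner (T x) x) <= M) -> numradius T <= M.
Proof.
move=> M0 hM; have [[r Dr]|D0] :=
  pselect ([set rnorm (inner (T x) x) | x in [set x | rnorm x = 1]] !=set0).
  by apply: ge_sup; [exists r|move=> _ [x /= x1 <-]; apply: hM].
by rewrite /numradius (_ : [set _ | _ in _] = set0) ?sup0 //; apply/nonemptyPn.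
Qed.

Lemma le_numradius T x : bounded_operator T ->
  rnorm (inner (T x) x) <= numradius T * rnorm x ^+ 2.
Proof.
move=> bT; have [linT _] := bT; have [M M0 hM] := bounded_operator_gt0 bT.
have [->|/unit_vector[v [v1 ->]]] := eqVneq x 0.
  by rewrite inner0r !rnorm0 expr0n mulr0.
rewrite (linZ linT) innerZl innerZr conjc_real mulrA -rmorphM.
rewrite rnormM rnormZ v1 mulr1 !rnormC normrM -expr2 mulrC ler_wpM2r ?sqr_ge0 //.
apply: ub_le_sup; last by exists v.
exists M => _ [y /= y1 <-]; apply: le_trans (inner_le _ _) _.
by rewrite y1 mulr1 -[M]mulr1 -y1.
Qed.

Lemma bounded_operator_comp S T : bounded_operator S -> bounded_operator T ->
  bounded_operator (S \o T).
Proof.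
move=> bS bT; have [linS _] := bS; have [linT _] := bT.
split; first by move=> a x y /=; rewrite linT linS.
have [M M0 hM] := bounded_operator_gt0 bS; have [N N0 hN] := bounded_operator_gt0 bT.
exists (M * N) => x /=; apply: le_trans (hM _) _.
by rewrite -mulrA ler_wpM2l // ltW.
Qed.

Lemma bounded_operatorD S T : bounded_operator S -> bounded_operator T -> bounded_operator (S + T).
Proof.
move=> [linS [M hM]] [linT [N hN]]; split.
  by move=> a x y; rewrite !fctE linS linT scalerDr addrACA.
exists (M + N) => x; rewrite fctE mulrDl; apply: le_trans (rnormD _ _) _; exact: lerD.
Qed.

Lemma bounded_operatorN T : bounded_operator T -> bounded_operator (- T).
Proof.
move=> [linT [M hM]]; split; first by move=> a x y; rewrite !fctE linT opprD scalerN.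
by exists M => x; rewrite fctE rnormN.
Qed.

End Bounds.

(** * Functional calculus *)

Section FunctionalCalculus.
Variables (R : realType) (H : hilbertType R).
Implicit Types (x y z u v w : H) (a c : R[i]) (T S P Q : H -> H) (f g : R -> R).

(** The defining property of [fcalc] with the operator norm replaced by pointwise
    bounds; the two agree by [representsP]. *)
Definition represents P f S := bounded_operator S /\
  forall e : R, 0 < e -> exists p : {poly R},
    (forall s : R, spectrum P s%:C%C -> `|p.[s] - f s| <= e) /\
    (forall x, rnorm (opoly p P x - S x) <= e * rnorm x).

Lemma representsP P f S : bounded_operator P -> represents P f S <->
  bounded_operator S /\ forall e : R, 0 < e -> exists p : {poly R},
      (forall s : R, spectrum P s%:C%C -> `|p.[s] - f s| <= e) /\
      opnorm (opoly p P - S) <= e.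
Proof.
move=> bP; have [linP _] := bP.
split=> -[bS hS]; split=> // e e0; have [p [h1 h2]] := hS _ e0; exists p; split=> //.
  by apply: opnorm_le; [exact: ltW | move=> x; exact: h2].
have bpS : bounded_operator (opoly p P - S)
  by apply: bounded_operatorD; [exact: opoly_bounded | exact: bounded_operatorN].
by move=> x; apply: le_trans (le_opnorm x bpS) _; rewrite ler_wpM2r ?rnorm_ge0.
Qed.

Variable P : H -> H.
Hypotheses (bP : bounded_operator P) (saP : self_adjoint P).
Let linP : linear P := bP.1.

(** Two polynomials close to f on the spectrum are close to each other there, hence
    have close values at P by [opoly_norm_le]. *)
Lemma represents_unique f S T : represents P f S -> represents P f T -> S = T.
Proof.
move=> [_ hS] [_ hT]; apply/funext => x.
apply: (@rdist_small_eq _ _ _ _ (4 * rnorm x)) => e e0.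
have [p [p1 p2]] := hS _ e0; have [q [q1 q2]] := hT _ e0.
have pq : rnorm (opoly p P x - opoly q P x) <= (2 * e) * rnorm x.
  rewrite -opolyB //; apply: opoly_norm_le => //; first by lra.
  move=> s ss; rewrite hornerD hornerN.
  have -> : p.[s] - q.[s] = (p.[s] - f s) - (q.[s] - f s) by ring.
  by apply: le_trans (ler_normB _ _) _; have := p1 _ ss; have := q1 _ ss; lra.
apply: le_trans (rdist_triangle (opoly p P x) _ _) _; rewrite rdistC.
have := rdist_triangle (opoly q P x) (opoly p P x) (T x).
by have := p2 x; have := q2 x; lra.
Qed.

Lemma fcalcE f S : represents P f S -> fcalc f P = S.
Proof.
move=> hS; apply: (@represents_unique f) => //; apply/representsP => //.
pose A : set (H -> H) := [set S | bounded_operator S /\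
  forall e : R, 0 < e -> exists p : {poly R},
      (forall s : R, spectrum P s%:C%C -> `|p.[s] - f s| <= e) /\
      opnorm (opoly p P - S) <= e].
by apply: (@getPex _ A); exists S; apply/representsP.
Qed.

Lemma represents_self_adjoint f S : represents P f S -> self_adjoint S.
Proof.
move=> [_ hS] x y; apply: (@rdist_small_eq _ _ _ _ (2 * (rnorm x * rnorm y))) => e e0.
have [p [_ hp]] := hS _ e0.
have -> : inner (S x) y - inner x (S y) =
   - inner (opoly p P x - S x) y + inner x (opoly p P y - S y).
  rewrite innerDl innerDr innerNl innerNr (opoly_self_adjoint linP p saP).
  by rewrite opprD opprK addrAC addrA addNr add0r addrC.
apply: le_trans (rnormD _ _) _; rewrite rnormN.
have h1 : rnorm (inner (opoly p P x - S x) y) <= e * (rnorm x * rnorm y).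
  apply: le_trans (inner_le _ _) _; rewrite mulrA.
  by rewrite ler_wpM2r ?rnorm_ge0.
have h2 : rnorm (inner x (opoly p P y - S y)) <= e * (rnorm x * rnorm y).
  apply: le_trans (inner_le _ _) _; rewrite mulrCA.
  by rewrite ler_wpM2l ?rnorm_ge0.
lra.
Qed.

(** The bounds on f and g make pq close to fg on the spectrum, and
    p(P)q(P) - ST = p(P)(q(P) - T) + (p(P) - S)T. *)
Lemma represents_comp f g S T (C : R) : 0 <= C ->
  (forall s : R, spectrum P s%:C%C -> `|f s| <= C /\ `|g s| <= C) ->
  represents P f S -> represents P g T -> represents P (fun s => f s * g s) (S \o T).
Proof.
move=> C0 hB [bS hS] [bT hT]; split; first exact: bounded_operator_comp.
move=> e e0; have [M M0 hM] := bounded_operator_gt0 bT.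
(* d is chosen so that (C + 1)d + Cd and (C + 1)d + Md are both at most e. *)
pose N := 2 * C + 1 + M; have N0 : 0 < N by rewrite /N; lra.
pose d := Num.min 1 (e / N).
have d0 : 0 < d by rewrite lt_min ltr01 /= divr_gt0.
have d1 : d <= 1 by rewrite ge_min lexx.
have dN : N * d <= e by rewrite mulrC -ler_pdivlMr // ge_min lexx orbT.
have [p [p1 p2]] := hS _ d0; have [q [q1 q2]] := hT _ d0.
have pB s : spectrum P s%:C%C -> `|p.[s]| <= C + 1.
  move=> ss; rewrite -[p.[s]](subrK (f s)); apply: le_trans (ler_normD _ _) _.
  by have := p1 _ ss; have [] := hB _ ss; lra.
have Cd : 0 <= C * d by rewrite mulr_ge0 // ltW.
have Md : 0 <= M * d by rewrite mulr_ge0 // ltW.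
exists (p * q); split.
  move=> s ss; rewrite hornerM.
  have -> : p.[s] * q.[s] - f s * g s = p.[s] * (q.[s] - g s) + g s * (p.[s] - f s) by ring.
  have h1 : `|p.[s] * (q.[s] - g s)| <= (C + 1) * d.
    by rewrite normrM ler_pM // ?pB // q1.
  have h2 : `|g s * (p.[s] - f s)| <= C * d.
    by rewrite normrM ler_pM // ?p1 //; have [] := hB _ ss.
  apply: le_trans (ler_normD _ _) _; move: dN; rewrite /N; lra.
move=> x /=; rewrite opolyM //.
apply: le_trans (rdist_triangle (opoly p P (T x)) _ _) _.
rewrite -(linB (opoly_linear linP p)).
have h1 : rnorm (opoly p P (opoly q P x - T x)) <= (C + 1) * (d * rnorm x).
  apply: le_trans (opoly_norm_le _ bP saP _ pB) _; first by lra.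
  by apply: ler_wpM2l; [lra | exact: q2].
have h2 : rnorm (opoly p P (T x) - S (T x)) <= d * (M * rnorm x).
  by apply: le_trans (p2 _) _; rewrite ler_wpM2l // ltW.
have h3 : (N * d) * rnorm x <= e * rnorm x by rewrite ler_wpM2r ?rnorm_ge0.
have h4 : 0 <= C * d * rnorm x by rewrite mulr_ge0 ?rnorm_ge0.
by move: h3; rewrite /N; lra.
Qed.

(** Polynomials that approximate f on [0, K] approximate it on the spectrum, so
    [opoly_norm_le] makes their values at each x satisfy the hypothesis of
    [approx_limit]. *)
Lemma represents_exists f (K : R) :
  (forall s : R, spectrum P s%:C%C -> 0 <= s <= K) -> approximable K f ->
  exists S, represents P f S.
Proof.
move=> hK hf.
pose close (e : R) (p : {poly R}) :=
  0 < e /\ forall s, 0 <= s <= K -> `|p.[s] - f s| <= e.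
have closeP (e : R) : 0 < e -> exists p, close e p.
  by move=> e0; have [p hp] := hf _ e0; exists p.
have /choice[S hS] : forall x, exists y, forall (e : R) p, close e p ->
    rnorm (opoly p P x - y) <= rnorm x * e.
  move=> x; pose F (e : R) y := exists2 p, close e p & y = opoly p P x.
  have [||l hl] := @approx_limit _ _ F (rnorm x).
  - by move=> e e0; have [p hp] := closeP _ e0; exists (opoly p P x), p.
  - move=> e1 e2 _ _ [p hp ->] [q hq ->]; rewrite -opolyB // mulrC.
    apply: opoly_norm_le => //; first by case: hp; case: hq; lra.
    move=> s /hK sK; rewrite hornerD hornerN.
    have -> : p.[s] - q.[s] = (p.[s] - f s) - (q.[s] - f s) by ring.
    by apply: le_trans (ler_normB _ _) _; apply: lerD; [exact: hp.2 | exact: hq.2].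
  by exists l => e p hp; apply: hl; exists p.
exists S; split; last first.
  move=> e e0; have [p hp] := closeP _ e0; exists p; split; first by move=> s /hK; apply: hp.2.
  by move=> x; rewrite mulrC; apply: hS.
have [p hp] := closeP _ ltr01.
split; last first.
  have [M M0 hM] := bounded_operator_gt0 (opoly_bounded linP p bP).
  exists (1 + M) => x; have := rdist_triangle (opoly p P x) (S x) 0; rewrite !subr0 rdistC.
  by have := hS x _ _ hp; have := hM x; lra.
move=> a x y.
apply: (@rdist_small_eq _ _ _ _ (rnorm (a *: x + y) + (rnorm a * rnorm x + rnorm y))) => e e0.
have {p hp} [p hp] := closeP _ e0.
apply: le_trans (rdist_triangle (opoly p P (a *: x + y)) _ _) _.
rewrite rdistC mulrDl; apply: lerD; first exact: hS.
rewrite (opoly_linear linP) opprD addrACA -scalerBr mulrDl.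
apply: le_trans (rnormD _ _) _; rewrite rnormZ -mulrA; apply: lerD; last exact: hS.
by rewrite ler_wpM2l ?rnorm_ge0 //; exact: hS.
Qed.

End FunctionalCalculus.

(** * Powers of a positive operator and the absolute value *)

Section Powers.
Variables (R : realType) (H : hilbertType R) (P : H -> H).
Hypotheses (bP : bounded_operator P) (saP : self_adjoint P).
Hypothesis posP : forall x, 0 <= rip (P x) x.
Implicit Types (x y z u v w : H) (s r : R) (S T : H -> H) (f g : R -> R).

Lemma represents_ext f g S :
  (forall s, spectrum P s%:C%C -> f s = g s) -> represents P f S -> represents P g S.
Proof.
move=> fg [bS hS]; split=> // e e0; have [p [h1 h2]] := hS _ e0.
by exists p; split=> // s ss; rewrite -fg //; apply: h1.
Qed.

Lemma opow_represents s : 0 <= s -> represents P (fun a => a `^ s) (opow P s).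
Proof.
move=> s0; have [K K0 hK] := spectrum_positive bP saP posP.
have [S hS] := represents_exists bP saP hK (approximable_powR K0 s0).
by rewrite /opow (fcalcE bP saP hS).
Qed.

Lemma opow_bounded s : 0 <= s -> bounded_operator (opow P s).
Proof. by move=> /opow_represents[]. Qed.

Lemma opow_self_adjoint s : 0 <= s -> self_adjoint (opow P s).
Proof. by move=> /opow_represents; apply: represents_self_adjoint. Qed.

Lemma opowD s r x : 0 <= s -> 0 <= r -> opow P s (opow P r x) = opow P (s + r) x.
Proof.
move=> s0 r0; have [K K0 hK] := spectrum_positive bP saP posP.
have h : represents P (fun a => a `^ (s + r)) (opow P s \o opow P r).
  apply: (@represents_ext (fun a => a `^ s * a `^ r)).
    move=> a _; have [sr|sr] := eqVneq (s + r) 0.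
      have -> : s = 0 by lra. have -> : r = 0 by lra.
      by rewrite addr0 !powRr0 mulr1.
    by rewrite powRD // (negPf sr).
  apply: (@represents_comp _ _ _ bP saP _ _ _ _ (K `^ s + K `^ r)).
  - by rewrite addr_ge0 ?powR_ge0.
  - move=> a /hK/andP[a0 aK]; rewrite !ger0_norm ?powR_ge0 //.
    split; [apply: ler_wpDr | apply: ler_wpDl]; rewrite ?powR_ge0 //.
    by apply: ge0_ler_powR; rewrite ?nnegrE ?(ltW K0).
    by apply: ge0_ler_powR; rewrite ?nnegrE ?(ltW K0).
  - exact: opow_represents.
  - exact: opow_represents.
by have /(congr1 (fun S => S x)) := represents_unique bP saP h (opow_represents (addr_ge0 s0 r0)).
Qed.

Lemma opow1 x : opow P 1 x = P x.
Proof.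
have [K K0 hK] := spectrum_positive bP saP posP.
have h : represents P (fun a => a `^ 1) P.
  split=> // e e0; exists 'X; split=> [s /hK/andP[s0 _]|y].
    by rewrite powRr1 // hornerX subrr normr0 ltW.
  by rewrite opolyX subrr rnorm0 mulr_ge0 ?rnorm_ge0 // ltW.
by have /(congr1 (fun S => S x)) := represents_unique bP saP (opow_represents ler01) h.
Qed.

Lemma rip_opow s r x : 0 <= s -> 0 <= r -> rip (opow P s x) (opow P r x) = rip (opow P (s + r) x) x.
Proof.
move=> s0 r0; rewrite ripC (ripJ _ _ (opow_self_adjoint r0)) opowD //.
by rewrite addrC ripC.
Qed.

Lemma rnorm_opow_sqr s x : 0 <= s -> rnorm (opow P s x) ^+ 2 = rip (opow P (2 * s) x) x.
Proof. by move=> s0; rewrite -rip_sqr rip_opow // -mulr2n mulr_natl. Qed.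

Lemma opow_ge0 s x : 0 <= s -> 0 <= rip (opow P s x) x.
Proof.
move=> s0; have -> : s = 2 * (s / 2) by lra.
by rewrite -rnorm_opow_sqr ?sqr_ge0 // divr_ge0.
Qed.

End Powers.

Section AbsoluteValue.
Variables (R : realType) (H : hilbertType R) (T : H -> H).
Hypothesis bT : bounded_operator T.
Implicit Types (x y z : H).

Let bT' := (adjointP bT).1.
Let adjT := (adjointP bT).2.

Lemma adjointE x y : inner (T x) y = inner x (adjoint T y). Proof. exact: adjT. Qed.

Lemma rip_adjoint x y : rip (T x) y = rip x (adjoint T y).
Proof. by rewrite /rip adjT. Qed.

Lemma gram_bounded : bounded_operator (adjoint T \o T).
Proof. exact: bounded_operator_comp. Qed.

Lemma gram_self_adjoint : self_adjoint (adjoint T \o T).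
Proof. by move=> x y /=; rewrite innerC -adjT -innerC adjT. Qed.

Lemma gram_ge0 x : 0 <= rip ((adjoint T \o T) x) x.
Proof. by rewrite /= ripC -rip_adjoint rip_sqr sqr_ge0. Qed.

Let half0 : (0 : R) <= 2^-1. Proof. by rewrite invr_ge0. Qed.

Lemma opabs_bounded : bounded_operator (opabs T).
Proof. exact: (opow_bounded gram_bounded gram_self_adjoint gram_ge0 half0). Qed.

Lemma opabs_self_adjoint : self_adjoint (opabs T).
Proof. exact: (opow_self_adjoint gram_bounded gram_self_adjoint gram_ge0 half0). Qed.

Lemma opabs_ge0 x : 0 <= rip (opabs T x) x.
Proof. exact: (opow_ge0 gram_bounded gram_self_adjoint gram_ge0 _ half0). Qed.

Lemma opabs_sqr x : opabs T (opabs T x) = adjoint T (T x).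
Proof.
rewrite /opabs (opowD gram_bounded gram_self_adjoint gram_ge0 _ half0 half0).
have -> : 2^-1 + 2^-1 = 1 :> R by lra.
by rewrite (opow1 gram_bounded gram_self_adjoint gram_ge0).
Qed.

Lemma rnorm_opabs x : rnorm (opabs T x) = rnorm (T x).
Proof.
apply/eqP; rewrite -(@eqrXn2 _ 2) ?rnorm_ge0 //; apply/eqP.
by rewrite -!rip_sqr (ripJ _ _ opabs_self_adjoint) opabs_sqr rip_adjoint.
Qed.

End AbsoluteValue.

(** * Polar decomposition *)

Section Polar.
Variables (R : realType) (H : hilbertType R).
Implicit Types (x y z u v w : H) (V : H -> Prop) (a : R[i]).

Definition adherent V w := forall e : R, 0 < e -> exists2 v, V v & rnorm (w - v) <= e.
Definition orthogonal_to V w := forall v, V v -> inner w v = 0.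

Lemma adherent_orthogonal V k w : orthogonal_to V k -> adherent V w -> inner k w = 0.
Proof.
move=> ok aw; apply: (@rdist_small_eq _ _ _ _ (rnorm k)) => e e0.
have [v Vv wv] := aw _ e0; rewrite subr0 -[w](subrK v) innerDr (ok _ Vv) addr0.
by apply: le_trans (inner_le _ _) _; rewrite ler_wpM2l ?rnorm_ge0.
Qed.

(** The pointwise projections form a linear map, since the decomposition of a vector
    into an adherent and an orthogonal part is unique. *)
Lemma orthogonal_projection V : V 0 -> (forall a y z, V y -> V z -> V (a *: y + z)) ->
  exists m : H -> H, [/\ linear m, forall x, adherent V (m x),
    forall x, orthogonal_to V (x - m x), forall v, V v -> m v = v &
    forall x, orthogonal_to V x -> m x = 0].
Proof.
move=> V0 Vlin.
have /choice[m hm] := fun x => projection x V0 Vlin.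
have oD a k l : orthogonal_to V k -> orthogonal_to V l -> orthogonal_to V (a *: k + l).
  by move=> ok ol v Vv; rewrite innerDl innerZl ok // ol // mulr0 addr0.
have aD a k l : adherent V k -> adherent V l -> adherent V (a *: k + l).
  move=> ak al e e0; have d0 : 0 < e / (rnorm a + 1).
    by rewrite divr_gt0 // ltr_wpDl // rnorm_ge0.
  have [v Vv hv] := ak _ d0; have [w Vw hw] := al _ d0.
  exists (a *: v + w); first exact: Vlin.
  rewrite opprD addrACA -scalerBr; apply: le_trans (rnormD _ _) _; rewrite rnormZ.
  have : rnorm a * rnorm (k - v) <= rnorm a * (e / (rnorm a + 1)).
    by rewrite ler_wpM2l ?rnorm_ge0.
  have : e = (rnorm a + 1) * (e / (rnorm a + 1)).
    by rewrite mulrC divfK // gt_eqF // ltr_wpDl // rnorm_ge0.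
  by rewrite mulrDl; lra.
have uniq x k l : adherent V k -> orthogonal_to V (x - k) ->
    adherent V l -> orthogonal_to V (x - l) -> k = l.
  move=> ak ok al ol; apply/eqP; rewrite -subr_eq0; apply/eqP/rnorm0_eq0/eqP.
  have akl : adherent V (k - l) by rewrite -scaleN1r addrC; apply: aD.
  have okl : orthogonal_to V (k - l).
    have -> : k - l = -1 *: (x - k) + (x - l).
      by rewrite scaleN1r opprB addrA subrK.
    exact: oD.
  by rewrite -sqrf_eq0 -rip_sqr /rip (adherent_orthogonal okl akl).
have am x : adherent V (m x) := (hm x).1.
have om x : orthogonal_to V (x - m x) := (hm x).2.
exists m; split=> //.
- move=> a x y; apply: (uniq (a *: x + y)) => //; first exact: aD.
  have -> : a *: x + y - (a *: m x + m y) = a *: (x - m x) + (y - m y).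
    by rewrite opprD addrACA scalerBr.
  exact: oD.
- move=> v Vv; apply: (uniq v) => //.
    by move=> e e0; exists v; rewrite ?subrr ?rnorm0 ?ltW.
  by move=> w _; rewrite subrr inner0l.
- move=> x ox; apply: (uniq x) => //; last by rewrite subr0.
  by move=> e e0; exists 0; rewrite ?subrr ?rnorm0 ?ltW.
Qed.

Lemma pythagoras x m : inner (x - m) m = 0 -> rnorm x ^+ 2 = rnorm (x - m) ^+ 2 + rnorm m ^+ 2.
Proof.
by move=> h; have := rnormD_sqr (x - m) m; rewrite subrK /rip h mulr0 addr0.
Qed.

(** Removing from x its component in the kernel of U does not change Ux and does not
    increase the norm; U is isometric on what remains. *)
Lemma partial_isometry_le (U : H -> H) x : partial_isometry U -> rnorm (U x) <= rnorm x.
Proof.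
move=> [bU isoU]; have [linU _] := bU; have [M M0 hM] := bounded_operator_gt0 bU.
pose V y := U y = 0.
have [||m [_ am om _ _]] := @orthogonal_projection V.
- exact: lin0.
- by move=> a y z Uy Uz; rewrite /V linU Uy Uz scaler0 addr0.
have Um : U (m x) = 0.
  apply: (@rdist_small_eq _ _ _ _ M) => e e0; have [v Vv hv] := am x _ e0.
  by rewrite -Vv -(linB linU); apply: le_trans (hM _) _; rewrite ler_wpM2l // ltW.
have -> : U x = U (x - m x) by rewrite (linB linU) Um subr0.
have -> : rnorm (U (x - m x)) = rnorm (x - m x).
  by rewrite /rnorm isoU //; exact: om.
rewrite -ler_sqr ?nnegrE ?rnorm_ge0 // (pythagoras (adherent_orthogonal (om x) (am x))).
by rewrite lerDl sqr_ge0.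
Qed.

Variable T : H -> H.
Hypothesis bT : bounded_operator T.

(** As || |T|z || = ||Tz||, the images Tz converge whenever |T|z does; U sends the
    projection m of x onto the closure of the range of |T| to the limit of Tz as |T|z
    tends to m.  Its kernel is the orthogonal complement of that range, which is the
    kernel of |T|. *)
Lemma polar_exists : exists U : H -> H,
  [/\ partial_isometry U, T = U \o opabs T & forall x, U x = 0 <-> T x = 0].
Proof.
have [linT _] := bT; set Q := opabs T; have bQ : bounded_operator Q := opabs_bounded bT.
have [linQ _] := bQ; have nQ x : rnorm (Q x) = rnorm (T x) := rnorm_opabs bT x.
have saQ : self_adjoint Q := opabs_self_adjoint bT.
pose V y := exists z, y = Q z.
have [||m [linm am om mV mo]] := @orthogonal_projection V.
- by exists 0; rewrite (lin0 linQ).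
- by move=> a _ _ [z ->] [z' ->]; exists (a *: z + z'); rewrite linQ.
have /choice[U hU] : forall x, exists y, forall (e : R) z,
    rnorm (m x - Q z) <= e -> rnorm (T z - y) <= e.
  move=> x; pose F (e : R) y := exists2 z, rnorm (m x - Q z) <= e & y = T z.
  have [||l hl] := @approx_limit _ _ F 1.
  - by move=> e e0; have [_ [z ->] hz] := am x _ e0; exists (T z), z.
  - move=> e1 e2 _ _ [z hz ->] [z' hz' ->]; rewrite mul1r -(linB linT) -nQ (linB linQ).
    apply: le_trans (rdist_triangle (m x) _ _) _; rewrite rdistC; exact: lerD.
  by exists l => e z hz; rewrite -[e]mul1r; apply: hl; exists z.
have nU x : rnorm (U x) = rnorm (m x).
  apply/eqP; rewrite eq_le; apply/andP; split; apply/ler_addgt0Pr => e e0.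
    have e2 : 0 < e / 2 by rewrite divr_gt0.
    have [_ [z ->] hz] := am x _ e2; have h1 := hU x _ _ hz.
    have := rdist_triangle (T z) (U x) 0; have := rdist_triangle (m x) (Q z) 0.
    by rewrite !subr0 nQ rdistC (rdistC (U x)); lra.
  have e2 : 0 < e / 2 by rewrite divr_gt0.
  have [_ [z ->] hz] := am x _ e2; have h1 := hU x _ _ hz.
  have := rdist_triangle (Q z) (m x) 0; have := rdist_triangle (U x) (T z) 0.
  by rewrite !subr0 nQ; lra.
have UQ z : U (Q z) = T z.
  apply: (@rdist_small_eq _ _ _ _ 1) => e e0; rewrite rdistC mul1r.
  by apply: hU; rewrite mV ?subrr ?rnorm0 ?ltW //; exists z.
have mle x : rnorm (m x) <= rnorm x.
  rewrite -ler_sqr ?nnegrE ?rnorm_ge0 // (pythagoras (adherent_orthogonal (om x) (am x))).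
  by rewrite lerDr sqr_ge0.
have linU : linear U.
  move=> a x y; apply: (@rdist_small_eq _ _ _ _ (2 * (rnorm a + 1))) => e e0.
  have [_ [z ->] hz] := am x _ e0; have [_ [z' ->] hz'] := am y _ e0.
  have h k l (p q : H) : rnorm (k - p) <= e -> rnorm (l - q) <= e ->
      rnorm (a *: k + l - (a *: p + q)) <= (rnorm a + 1) * e.
    move=> h1 h2; rewrite opprD addrACA -scalerBr mulrDl mul1r.
    by apply: le_trans (rnormD _ _) _; rewrite rnormZ lerD // ler_wpM2l ?rnorm_ge0.
  have h1 : rnorm (T (a *: z + z') - U (a *: x + y)) <= (rnorm a + 1) * e.
    by apply: hU; rewrite linm linQ; apply: h.
  have h2 : rnorm (T (a *: z + z') - (a *: U x + U y)) <= (rnorm a + 1) * e.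
    by rewrite linT; apply: h; apply: hU.
  apply: le_trans (rdist_triangle (T (a *: z + z')) _ _) _; rewrite rdistC; lra.
have U0 x : U x = 0 -> m x = 0 by move=> Ux; apply: rnorm0_eq0; rewrite -nU Ux rnorm0.
have m0 x : m x = 0 -> U x = 0 by move=> mx; apply: rnorm0_eq0; rewrite nU mx rnorm0.
exists U; split.
- split; first by split=> //; exists 1 => x; rewrite mul1r nU.
  move=> x ox; rewrite !norm_rnorm nU; congr (_%:C)%C.
  have /ox h : U (x - m x) = 0 by apply: m0; apply: mo; apply: om.
  have xm := adherent_orthogonal (om x) (am x).
  have xm0 : x - m x = 0.
    apply: rnorm0_eq0; apply/eqP; rewrite -sqrf_eq0 -rip_sqr /rip.
    by rewrite innerDr innerNr xm subr0 innerC h conjc0.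
  by rewrite -{2}[x](subrK (m x)) xm0 add0r.
- by apply/funext => z /=; rewrite UQ.
move=> x; split=> [/U0 mx|Tx].
  apply: rnorm0_eq0; rewrite -nQ; have -> : Q x = 0; last exact: rnorm0.
  apply: inner_injr => z; rewrite inner0r -saQ innerC.
  have /om : V (Q z) by exists z.
  by move=> /(_ x); rewrite mx subr0 => ->; rewrite conjc0.
apply: m0; apply: mo => _ [z ->]; rewrite -saQ.
have -> : Q x = 0 by apply: rnorm0_eq0; rewrite nQ Tx rnorm0.
by rewrite inner0l.
Qed.

Lemma polar_isometryP : [/\ partial_isometry (polar_isometry T),
  T = polar_isometry T \o opabs T & forall x, polar_isometry T x = 0 <-> T x = 0].
Proof.
pose A : set (H -> H) := [set U | [/\ partial_isometry U, T = U \o opabs T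
                 & forall x, U x = 0 <-> T x = 0]].
by apply: (@getPex _ A); exact: polar_exists.
Qed.
End Polar.

(** * The weighted Aluthge transform *)

Section Symmetric.
Variables (R : realType) (H : hilbertType R).
Implicit Types (x y z : H).

(** The norm of a symmetric operator is its numerical radius: polarization gives
    4 Re<Dx, y> <= 2w (||x||^2 + ||y||^2), applied to the multiple y of Dx that has
    the norm of x. *)
Lemma symmetric_norm_le (D : H -> H) (w : R) x : linear D ->
  (forall x y, rip (D x) y = rip x (D y)) ->
  (forall x, `|rip (D x) x| <= w * rnorm x ^+ 2) -> rnorm (D x) <= w * rnorm x.
Proof.
move=> linD' symD hw.
have polar u v : 2 * rip (D u) v <= w * (rnorm u ^+ 2 + rnorm v ^+ 2).
  have h1 := le_trans (ler_norm _) (hw (u + v)).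
  have := hw (u - v); rewrite ler_norml => /andP[h2 _].
  move: h1 h2; rewrite (rnormD_sqr u) (rnormB_sqr u) (linD linD') (linB linD') !ripE.
  by rewrite (ripC (D v) u) -symD; lra.
have [Dx|Dx] := eqVneq (rnorm (D x)) 0.
  have [x0|x0] := eqVneq x 0; first by rewrite Dx x0 rnorm0 mulr0.
  have [v [v1 _]] := unit_vector x0.
  have w0 : 0 <= w by have := le_trans (normr_ge0 _) (hw v); rewrite v1 expr1n mulr1.
  by rewrite Dx mulr_ge0 ?rnorm_ge0.
have [x0|x0] := eqVneq (rnorm x) 0.
  by move: Dx; rewrite (rnorm0_eq0 x0) (lin0 linD') rnorm0 eqxx.
have xp : 0 < rnorm x by rewrite lt_neqAle eq_sym x0 rnorm_ge0.
have Dp : 0 < rnorm (D x) by rewrite lt_neqAle eq_sym Dx rnorm_ge0.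
have := polar x ((rnorm x / rnorm (D x))%:C%C *: D x).
rewrite ripZr rip_sqr rnormZ rnormC ger0_norm; last by rewrite divr_ge0 // ltW.
have -> : rnorm x / rnorm (D x) * rnorm (D x) ^+ 2 = rnorm x * rnorm (D x) by field.
by rewrite divfK // => h; rewrite -(ler_pM2l xp); lra.
Qed.
End Symmetric.

Section Aluthge.
Variables (R : realType) (H : hilbertType R) (A : H -> H) (t : R).
Hypotheses (bA : bounded_operator A) (ht0 : 0 <= t) (ht1 : t <= 1).
Implicit Types (x y z : H) (s : R).

Let Q := opabs A.
Let bQ : bounded_operator Q := opabs_bounded bA.
Let saQ : self_adjoint Q := opabs_self_adjoint bA.
Let posQ : forall x, 0 <= rip (Q x) x := opabs_ge0 bA.
Let U := polar_isometry A.
Let ht1' : 0 <= 1 - t. Proof. by rewrite subr_ge0. Qed.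
Let isoU : partial_isometry U. Proof. by case: (polar_isometryP bA). Qed.
Let bU : bounded_operator U := isoU.1.
Let At := aluthge A t.
Let X := opow Q (1 - t).
Let Z := opow Q t.
Let bX : bounded_operator X := opow_bounded bQ saQ posQ ht1'.
Let bZ : bounded_operator Z := opow_bounded bQ saQ posQ ht0.
Let saX : self_adjoint X := opow_self_adjoint bQ saQ posQ ht1'.
Let saZ : self_adjoint Z := opow_self_adjoint bQ saQ posQ ht0.

Lemma aluthge_bounded : bounded_operator (aluthge A t).
Proof. exact: bounded_operator_comp (bounded_operator_comp bX bU) bZ. Qed.
Let bAt : bounded_operator At := aluthge_bounded.
Let bAs : bounded_operator (adjoint At) := (adjointP bAt).1.

Lemma polar_factor x : A x = U (Z (X x)).
Proof.
have [_ AE _] := polar_isometryP bA; rewrite [LHS](congr1 (fun T => T x) AE) /=.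
have h : t + (1 - t) = 1 by ring.
by rewrite /Z /X (opowD bQ saQ posQ) // h (opow1 bQ saQ posQ).
Qed.

Let C x : H := (opow Q (2 * t) + opow Q (2 * (1 - t))) x.

Let t2 : 0 <= 2 * t. Proof. by rewrite mulr_ge0. Qed.
Let t2' : 0 <= 2 * (1 - t). Proof. by rewrite mulr_ge0. Qed.

(** The cross term is <|A|^(2t)x, |A|^(2(1-t))x> = <|A|^2 x, x> = ||Ax||^2. *)
Lemma modulus_part_sqr x :
  rnorm (C x) ^+ 2 <=
    (opnorm (opow Q (4 * t) + opow Q (4 * (1 - t))) + 2 * opnorm A ^+ 2) * rnorm x ^+ 2.
Proof.
rewrite /C fctE rnormD_sqr !(rnorm_opow_sqr bQ saQ posQ) // (rip_opow bQ saQ posQ) //.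
have -> : 2 * (2 * t) = 4 * t by ring.
have -> : 2 * (2 * (1 - t)) = 4 * (1 - t) by ring.
have -> : 2 * t + 2 * (1 - t) = 2 * 1 by ring.
rewrite -(rnorm_opow_sqr bQ saQ posQ) // (opow1 bQ saQ posQ) (rnorm_opabs bA).
set G := opow Q (4 * t) + opow Q (4 * (1 - t)).
have bG : bounded_operator G.
  by apply: bounded_operatorD; apply: (opow_bounded bQ saQ posQ); rewrite mulr_ge0.
have h1 : rip (opow Q (4 * t) x) x + rip (opow Q (4 * (1 - t)) x) x <= opnorm G * rnorm x ^+ 2.
  rewrite -ripDl; apply: le_trans (rip_le _ _) _; rewrite expr2 mulrA.
  by rewrite ler_wpM2r ?rnorm_ge0 //; exact: (le_opnorm x bG).
have h2 : rnorm (A x) ^+ 2 <= opnorm A ^+ 2 * rnorm x ^+ 2.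
  rewrite -exprMn ler_sqr ?nnegrE ?rnorm_ge0 ?mulr_ge0 ?opnorm_ge0 ?rnorm_ge0 //.
  exact: le_opnorm.
move: h1 h2; move: (rip _ _) (rip _ _) (rnorm (A x) ^+ 2) (opnorm A ^+ 2).
by move: (rnorm x ^+ 2) (opnorm G) => n g q1 q2 q a; lra.
Qed.

Variables (c : R[i]).
Hypothesis c1 : rnorm c = 1.

Let c1' : rnorm (conjc c) = 1.
Proof. by rewrite /rnorm normcJ; exact: c1. Qed.

Let D x := c *: At x + conjc c *: adjoint At x.

Let linD' : linear D.
Proof.
move=> a x y; rewrite /D bAt.1 bAs.1 !scalerDr !scalerA !(mulrC a) addrACA.
by [].
Qed.

Let symD x y : rip (D x) y = rip x (D y).
Proof.
rewrite /D ripDl ripDr addrC; congr (_ + _).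
  by rewrite /rip innerC innerZr conjcK -(adjointE bAt) -innerZl innerC conjcK.
by rewrite /rip innerZl (adjointE bAt) innerZr conjcK.
Qed.

Let ripD x : rip (D x) x = 2 * rip (c *: At x) x.
Proof.
rewrite /D ripDl [X in _ + X](_ : _ = rip (c *: At x) x); first by ring.
rewrite /rip [in LHS]innerZl innerC -(adjointE bAt) innerZl.
by rewrite -[conjc c]conjcK; case: (inner _ _) c => u v [p q] /=; ring.
Qed.

Lemma rotated_part_numradius x : `|rip (D x) x| <= 2 * numradius At * rnorm x ^+ 2.
Proof.
rewrite ripD normrM ger0_norm // -mulrA ler_pM2l //.
apply: le_trans (le_numradius x bAt).
rewrite -[leRHS]mul1r -c1 -rnormM -innerZl /rip.
by rewrite -lecR -norm_rnorm normc_ge_Re.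
Qed.

(** The cross term is Re<c At x, c^* At^* x> = Re c^2 <At At x, x>. *)
Lemma rotated_part_sqr x : rnorm (D x) ^+ 2 <=
  (opnorm ((opabs At \o opabs At) + (opabs (adjoint At) \o opabs (adjoint At)))
   + 2 * numradius (At \o At)) * rnorm x ^+ 2.
Proof.
set G : H -> H := (opabs At \o opabs At) + (opabs (adjoint At) \o opabs (adjoint At)).
have bG : bounded_operator G.
  by apply: bounded_operatorD; apply: bounded_operator_comp; apply: opabs_bounded.
rewrite rnormD_sqr !rnormZ c1 c1' !mul1r mulrDl.
have h1 : rnorm (At x) ^+ 2 + rnorm (adjoint At x) ^+ 2 <= opnorm G * rnorm x ^+ 2.
  have -> : rnorm (At x) ^+ 2 + rnorm (adjoint At x) ^+ 2 = rip (G x) x.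
    rewrite ripDl /=; congr (_ + _).
      by rewrite (ripJ _ _ (opabs_self_adjoint bAt)) rip_sqr (rnorm_opabs bAt).
    by rewrite (ripJ _ _ (opabs_self_adjoint bAs)) rip_sqr (rnorm_opabs bAs).
  apply: le_trans (rip_le _ _) _; rewrite expr2 mulrA.
  by rewrite ler_wpM2r ?rnorm_ge0 //; exact: (le_opnorm x bG).
have h2 : rip (c *: At x) (conjc c *: adjoint At x) <= numradius (At \o At) * rnorm x ^+ 2.
  apply: le_trans (le_numradius x (bounded_operator_comp bAt bAt)).
  rewrite /rip innerZl innerZr conjcK -(adjointE bAt) mulrA.
  have -> : rnorm (inner ((At \o At) x) x) = rnorm (c * c * inner (At (At x)) x).
    by rewrite !rnormM c1 !mul1r.
  by apply: le_trans (ler_norm _) _; rewrite -lecR -norm_rnorm normc_ge_Re.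
by lra.
Qed.

(** With B = cX + Z U^*, the vector on the left is B^* y, and its squared norm is
    <B B^* y, y>; only ||UZy|| <= ||Zy|| is lost. *)
Lemma factor_adjoint_sqr y :
  rnorm (conjc c *: X y + U (Z y)) ^+ 2 <= rip (C y + D y) y.
Proof.
rewrite ripDl ripD rnormD_sqr rnormZ c1' mul1r /C fctE ripDl.
rewrite -!(rnorm_opow_sqr bQ saQ posQ) //.
have hU : rnorm (U (Z y)) ^+ 2 <= rnorm (Z y) ^+ 2.
  by rewrite ler_sqr ?nnegrE ?rnorm_ge0 // partial_isometry_le.
have -> : rip (conjc c *: X y) (U (Z y)) = rip (c *: At y) y.
  rewrite ripC /rip innerZr innerZl conjcK; congr (complex.Re (_ * _)).
  by rewrite -saX.
by move: hU; rewrite /X /Z; lra.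
Qed.

(** For b = Bx one has ||b||^2 = <x, B^* b> <= ||x|| ||B^* b|| and
    ||B^* b||^2 <= k ||b||^2 by [factor_adjoint_sqr], hence ||b||^2 <= k ||x||^2. *)
Lemma rotated_bound (k : R) x : 0 <= k -> (forall y, rnorm (C y + D y) <= k * rnorm y) ->
  4 * complex.Re (c * inner (A x) x) <= k * rnorm x ^+ 2.
Proof.
move=> k0 hk; set v := Z (adjoint U x); set b := c *: X x + v.
have h1 : 4 * complex.Re (c * inner (A x) x) <= rnorm b ^+ 2.
  have -> : complex.Re (c * inner (A x) x) = rip (c *: X x) v.
    by rewrite /rip innerZl polar_factor (adjointE bU) saZ.
  have := sqr_ge0 (rnorm (c *: X x - v)); rewrite rnormB_sqr rnormD_sqr; lra.
apply: le_trans h1 _.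
have [->|b0] := eqVneq (rnorm b) 0; first by rewrite expr0n mulr_ge0 ?sqr_ge0.
have bp : 0 < rnorm b by rewrite lt_neqAle eq_sym b0 rnorm_ge0.
set b' := conjc c *: X b + U (Z b).
have h2 : rnorm b' ^+ 2 <= k * rnorm b ^+ 2.
  apply: le_trans (factor_adjoint_sqr b) _; apply: le_trans (rip_le _ _) _.
  by rewrite expr2 mulrA ler_wpM2r ?rnorm_ge0.
have h3 : rnorm b ^+ 2 <= rnorm x * rnorm b'.
  rewrite -rip_sqr; suff -> : rip b b = rip x b' by exact: rip_le.
  transitivity (rip (c *: X x) b + rip v b); first by rewrite -ripDl.
  rewrite /b' [RHS]ripDr; congr (_ + _).
    by rewrite /rip innerZl innerZr conjcK saX.
  by rewrite /v (ripJ _ _ saZ) ripC -(rip_adjoint bU) ripC.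
have h4 : (rnorm b ^+ 2) ^+ 2 <= (rnorm x * rnorm b') ^+ 2.
  by rewrite ler_sqr ?nnegrE ?sqr_ge0 ?mulr_ge0 ?rnorm_ge0.
have h5 : rnorm x ^+ 2 * rnorm b' ^+ 2 <= rnorm x ^+ 2 * (k * rnorm b ^+ 2).
  by rewrite ler_wpM2l ?sqr_ge0.
rewrite [leRHS]exprMn in h4; have := le_trans h4 h5.
by rewrite mulrA [leLHS]expr2 ler_pM2r ?exprn_gt0 // mulrC.
Qed.

Lemma sum_bound x :
  rnorm (C x + D x) ^+ 2 <=
    (opnorm (opow Q (4 * t) + opow Q (4 * (1 - t))) + 2 * opnorm A ^+ 2
     + opnorm ((opabs At \o opabs At) + (opabs (adjoint At) \o opabs (adjoint At)))
     + 2 * numradius (At \o At)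
     + 4 * (opnorm (opow Q (2 * t) + opow Q (2 * (1 - t))) * numradius At)) * rnorm x ^+ 2.
Proof.
have h1 := modulus_part_sqr x; have h2 := rotated_part_sqr x.
have bC : bounded_operator (opow Q (2 * t) + opow Q (2 * (1 - t))).
  by apply: bounded_operatorD; apply: (opow_bounded bQ saQ posQ).
have hC : rnorm (C x) <= opnorm (opow Q (2 * t) + opow Q (2 * (1 - t))) * rnorm x.
  exact: le_opnorm.
have hD : rnorm (D x) <= 2 * numradius At * rnorm x.
  by apply: symmetric_norm_le => //; exact: rotated_part_numradius.
have h3 : rip (C x) (D x) <= 2 * (opnorm (opow Q (2 * t) + opow Q (2 * (1 - t))) * numradius At)
     * rnorm x ^+ 2.
  apply: le_trans (rip_le _ _) _.
  have := ler_pM (rnorm_ge0 _) (rnorm_ge0 _) hC hD.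
  move: {h1 h2} (rnorm (C x)) (rnorm (D x)) (rnorm x) (numradius At) (opnorm _) => d e n w g; lra.
move: h1 h2 h3; rewrite rnormD_sqr.
move: (rnorm (C x) ^+ 2) (rip _ _) (rnorm (D x) ^+ 2) (rnorm x ^+ 2) (opnorm A ^+ 2).
move: (numradius (At \o At)) (numradius At) (opnorm (opow Q (4 * t) + _)).
move: (opnorm (opow Q (2 * t) + _)) (opnorm _) => g1 g2 w2 w g3 m2 r d2 n a2.
lra.
Qed.

End Aluthge.

Theorem theorem2p1 (R : realType) (H : hilbertType R) (A : H -> H) (t : R)
    (hA : bounded_operator A) (ht0 : 0 <= t) (ht1 : t <= 1) :
  let At := aluthge A t in
  let Atstar := adjoint (aluthge A t) in
  numradius A <=
    2^-1 * Num.sqrt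
      (4^-1 * opnorm (opow (opabs A) (4 * t) + opow (opabs A) (4 * (1 - t)))
       + 2^-1 * opnorm A ^+ 2
       + 4^-1 * opnorm ((opabs At \o opabs At) + (opabs Atstar \o opabs Atstar))
       + 2^-1 * numradius (At \o At)
       + opnorm (opow (opabs A) (2 * t) + opow (opabs A) (2 * (1 - t)))
         * numradius At).
Proof.
cbv zeta; set At := aluthge A t; set Atstar := adjoint At; set N := (X in Num.sqrt X).
apply: numradius_le; first by rewrite mulr_ge0 ?sqrtr_ge0.
move=> x x1; have [c c1 hc] := rotation (inner (A x) x).
have hk y : rnorm ((opow (opabs A) (2 * t) + opow (opabs A) (2 * (1 - t))) y
     + (c *: At y + conjc c *: Atstar y)) <= 2 * Num.sqrt N * rnorm y.
  have h := sum_bound hA ht0 ht1 c1 y; rewrite -/At -/Atstar in h.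
  have {}h : rnorm ((opow (opabs A) (2 * t) + opow (opabs A) (2 * (1 - t))) y
     + (c *: At y + conjc c *: Atstar y)) ^+ 2 <= 4 * N * rnorm y ^+ 2.
    apply: le_trans h _; rewrite /N.
    move: (opnorm A ^+ 2) (numradius (At \o At)) (numradius At) (rnorm y ^+ 2).
    move: (opnorm _) (opnorm (opow _ (2 * t) + _)) (opnorm (opow _ (4 * t) + _)).
    by move=> g1 g2 g3 a w2 w n; lra.
  have [y0|y0] := eqVneq (rnorm y) 0.
    move: h; rewrite y0 expr0n !mulr0 => h.
    by rewrite -(@ler_sqr) ?nnegrE ?rnorm_ge0 ?expr0n.
  have yp : 0 < rnorm y by rewrite lt_neqAle eq_sym y0 rnorm_ge0.
  have N0 : 0 <= N.
    have := le_trans (sqr_ge0 _) h; rewrite pmulr_lge0 ?exprn_gt0 //.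
    by rewrite pmulr_rge0.
  rewrite -ler_sqr ?nnegrE ?rnorm_ge0 ?mulr_ge0 ?sqrtr_ge0 ?rnorm_ge0 //.
  by apply: le_trans h _; rewrite !exprMn sqr_sqrtr //; lra.
have := rotated_bound hA ht0 ht1 c1 x (_ : 0 <= 2 * Num.sqrt N) hk.
by rewrite mulr_ge0 ?sqrtr_ge0 // => /(_ isT); rewrite hc x1 expr1n /=; lra.
Qed.
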